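(* For all $s\le 0$ and $m\le 0$, the Blahut–Arimoto-type algorithm described in the context (Algorithm 1, whose $P_{T|X}$-minimization step is carried out by Algorithm 2, with parameter $\beta\in(0,1)$) converges to the rate-distortion-cost function $R(D_{s,m},C_{s,m})$. That is, the fixed-point iterations and the subgradient loop of Algorithm 2 converge, and, with $P^{(k)}_{T|X},Q^{(k)}_{T,Y},Q^{(k)}_A$ the iterates of Algorithm 1, $$sD_{s,m}+mC_{s,m}+F\big(P^{(k)}_{T|X},Q^{(k)}_{T,Y},Q^{(k)}_A\big)\longrightarrow R(D_{s,m},C_{s,m})\qquad(k\to\infty),$$ where $$C_{s,m}=\sum_{t,x}P_X(x)P^*_{T|X}(t|x)\Delta(\mathrm{a}(t)),\qquad D_{s,m}=\sum_{t,x,y}P_X(x)P^*_{T|X}(t|x)P_{Y|X,A}(y|x,\mathrm{a}(t))\,d(x,t(y)),$$ and $P^*_{T|X}$ is a minimizing $P_{T|X}$ in $\min_{P_{T|X},Q_{T,Y},Q_A}F(P_{T|X},Q_{T,Y},Q_A)$.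
   Context: Setting. All alphabets $\mathcal{X}$ (source), $\hat{\mathcal{X}}$ (reconstruction), $\mathcal{Y}$ (side information), $\mathcal{A}$ (actions) are finite. Fixed data: a pmf $P_X$ on $\mathcal{X}$ with $P_X(x)>0$ for all $x$; a conditional pmf $P_{Y|X,A}$; an action cost $\Delta:\mathcal{A}\to\mathbb{R}_+$ with $\Delta(a)=0$ for some $a$ and $\max_a\Delta(a)<\infty$; a distortion $d:\mathcal{X}\times\hat{\mathcal{X}}\to\mathbb{R}_+$ such that for each $x$ there is $\hat x$ with $d(x,\hat x)=0$. Logarithms are base 2, with the usual conventions ($0\log 0=0$, and a term with coefficient $0$ multiplying $\log 0$ is $0$); $D_{KL}(P\|Q)=\sum_iP(i)\log\frac{P(i)}{Q(i)}$. A Shannon strategy is a vector $t\in\mathcal{T}\subseteq\hat{\mathcal{X}}^{|\mathcal{Y}|}\times\mathcal{A}$ whose first $|\mathcal{Y}|$ entries are indexed by $y\in\mathcal{Y}$ and denoted $t(y)\in\hat{\mathcal{X}}$, and whose last entry is denoted $\mathrm{a}(t)\in\mathcal{A}$; $\mathcal{T}$ is the strategy alphabet and $\mathcal{T}^a=\{t\in\mathcal{T}:\mathrm{a}(t)=a\}$. Given a conditional pmf $P_{T|X}$ (from $\mathcal{X}$ to $\mathcal{T}$), set $P_{X,Y,T}(x,y,t)=P_X(x)P_{T|X}(t|x)P_{Y|X,A}(y|x,\mathrm{a}(t))$ and $A=\mathrm{a}(T)$; $P_{Y,A}$ and $P_{Y,T|X}$ are computed from it. Rate-distortion-cost function: $R(D,C)=\min_{P_{T|X}}I(X;\mathrm{a}(T))+I(X;T\mid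 Y,\mathrm{a}(T))$ subject to $\mathbb{E}[\Delta(\mathrm{a}(T))]\le C$, $\mathbb{E}[d(X,T(Y))]\le D$. Objective: for fixed $s,m\le 0$, a conditional pmf $P_{T|X}$, a pmf $Q_{T,Y}$ on $\mathcal{T}\times\mathcal{Y}$ and a pmf $Q_A$ on $\mathcal{A}$, $$\begin{aligned}F(P_{T|X},Q_{T,Y},Q_A)={}&\sum_{y,a}P_{Y,A}(y,a)\log\frac{P_{Y,A}(y,a)}{Q_A(a)}-\sum_{x,y,t}P_{X,Y,T}(x,y,t)\log P_{Y|X,A}(y|x,\mathrm{a}(t))\\&+\sum_xP_X(x)D_{KL}(P_{Y,T|X}(\cdot,\cdot|x)\|Q_{T,Y})-s\sum_{x,y,t}P_{X,Y,T}(x,y,t)d(x,t(y))\\&-m\sum_{t,x}\Delta(\mathrm{a}(t))P_X(x)P_{T|X}(t|x).\end{aligned}$$ Algorithm 1 (input $s,m\le0$). Initialize a conditional pmf $P_{T|X}$. Repeat until convergence: (i) $Q_A(a)\leftarrow\sum_{x\in\mathcal{X},t\in\mathcal{T}^a}P_X(x)P_{T|X}(t|x)$; (ii) $Q_{T,Y}(t,y)\leftarrow\sum_{x}P_X(x)P_{Y|X,A}(y|x,\mathrm{a}(t))P_{T|X}(t|x)$; (iii) $P_{T|X}\leftarrow$ the output of Algorithm 2 for the current $Q_{T,Y},Q_A$ (minimization of $F$ over $P_{T|X}$). Algorithm 2 (input $Q_{T,Y},Q_A$; parameters: a constant $\beta\in(0,1)$ and subgradient weights $\theta_i=1/(i+1)$,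 $i=0,1,\dots$). Put $$\alpha_{t,x}=Q_A(\mathrm{a}(t))\,2^{m\Delta(\mathrm{a}(t))}\,2^{\sum_{y}P_{Y|X,A}(y|x,\mathrm{a}(t))[s\,d(x,t(y))+\log Q_{T,Y}(t,y)]},\qquad\alpha_{a,x}=\sum_{t\in\mathcal{T}^a}\alpha_{t,x},$$ and, for an array $P_{A|X}=(P_{A|X}(a|x))_{a,x}$ (not necessarily normalized) and $\mu_x\in\mathbb{R}$, $$g_{a|x}(P_{A|X},\mu_x)=P_{A|X}(a|x)^{\beta}\left(\frac{2^{\mu_x}\alpha_{a,x}}{\prod_{y}\big[\sum_{\tilde x}P_X(\tilde x)P_{Y|X,A}(y|\tilde x,a)P_{A|X}(a|\tilde x)\big]^{P_{Y|X,A}(y|x,a)}}\right)^{1-\beta}.$$ Initialize $i=0$, $\mu^{(0)}_x=1$ for all $x$, and $P^{(0)}_{A|X}(a|x)=1/|\mathcal{T}|$ for all $a,x$. Repeat until convergence: (1) starting from $P^{(i)}_{A|X}$, iterate the map $P_{A|X}\mapsto\big(g_{a|x}(P_{A|X},\mu^{(i)}_x)\big)_{a,x}$ until convergence, and call the limit $P^{(i+1)}_{A|X}$; (2) set $\mu^{(i+1)}_x=\mu^{(i)}_x+\frac{\theta_i}{P_X(x)}\big(1-\sum_{a}P^{(i+1)}_{A|X}(a|x)\big)$ for all $x$; (3) $i\leftarrow i+1$. Output $P_{T|X}(t|x)=\frac{\alpha_{t,x}}{\alpha_{\mathrm{a}(t),x}}P_{A|X}(\mathrm{a}(t)|x)$,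 where $P_{A|X}$ is the converged array. ''Until convergence'' in a loop means that the loop is run to its limit.
   Formalization: The initial conditional pmf P_{T|X} is required to be strictly positive; with an arbitrary one (e.g. a point mass on a bad strategy) unused strategies keep α_{t,x}=0 forever and the algorithm need not reach R(D,C). *)

(* Defs.v *)
From HB Require Import structures.
From mathcomp Require Import all_boot all_order all_algebra.
From mathcomp Require Import all_classical all_reals all_analysis.
Set Implicit Arguments.
Unset Strict Implicit.
Unset Printing Implicit Defensive.
Import Order.TTheory GRing.Theory Num.Theory.
Import numFieldNormedType.Exports.
Local Open Scope classical_set_scope.
Local Open Scope ring_scope.

Section Information.
Context {R : realType}.

(* [log2] is only used where a zero argument has a zero coefficient.
   [elog2] is the extended logarithm: [elog2 0 = -oo], [elog2 +oo = +oo].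
   In [\bar R] we have [0 * -oo = 0 * +oo = 0] and [p%:E / 0 = +oo] for [0 < p],
   so the usual conventions for [0 log 0], [0 log (0 / 0)] and
   [p log (p / 0) = +oo] hold in [kl_term] and in [F] below. *)
Definition log2 (x : R) : R := ln x / ln 2.

Definition elog2 (x : \bar R) : \bar R := (lne x * ((ln 2)^-1)%:E)%E.

(* [2 ^ x], with [2 ^ -oo = 0] *)
Definition exp2e (x : \bar R) : \bar R := expeR (x * (ln 2)%:E)%E.

Definition is_pmf (I : finType) (p : I -> R) : Prop :=
  (forall i, 0 <= p i) /\ \sum_i p i = 1.

Definition cond_pmf (I J : finType) (p : I -> J -> R) : Prop :=
  forall i, is_pmf (p i).

Definition kl_term (p q : R) : \bar R := (p%:E * elog2 (p%:E / q%:E))%E.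

Definition kl_div (I : finType) (p q : I -> R) : \bar R :=
  (\sum_i kl_term (p i) (q i))%E.

(* I(U;V) for the joint pmf [p u v] *)
Definition mutual_info (U V : finType) (p : U -> V -> R) : R :=
  \sum_u \sum_v
    p u v * log2 (p u v / ((\sum_v' p u v') * (\sum_u' p u' v))).

(* I(U;V|Z) for the joint pmf [p u v z] *)
Definition cond_mutual_info (U V Z : finType) (p : U -> V -> Z -> R) : R :=
  \sum_u \sum_v \sum_z
    p u v z * log2 (p u v z * (\sum_u' \sum_v' p u' v' z)
                    / ((\sum_v' p u v' z) * (\sum_u' p u' v z))).

End Information.

Section Strategies.
Variables (Xh Y A : finType) (TT : {set {ffun Y -> Xh} * A}).

Definition strategy : Type := {t : {ffun Y -> Xh} * A | t \in TT}.

Definition recon (t : strategy) (y : Y) : Xh := (val t).1 y.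
Definition act (t : strategy) : A := (val t).2.

End Strategies.

Section RateDistortionCost.
Context {R : realType} {X Xh Y A : finType}.
(* [W x a y] is P_{Y|X,A}(y|x,a) *)
Variables (PX : X -> R) (W : X -> A -> Y -> R).
Variables (Delta : A -> R) (d : X -> Xh -> R).
Variable TT : {set {ffun Y -> Xh} * A}.
Local Notation T := (strategy TT).
(* [P x t] is P_{T|X}(t|x) *)
Implicit Types P : X -> T -> R.

Definition PXYT P (x : X) (y : Y) (t : T) : R := PX x * P x t * W x (act t) y.

Definition PXA P (x : X) (a : A) : R := \sum_(t | act t == a) PX x * P x t.

Definition PYA P (y : Y) (a : A) : R :=
  \sum_x \sum_(t | act t == a) PXYT P x y t.

Definition PTY_X P (x : X) (ty : T * Y) : R := P x ty.1 * W x (act ty.1) ty.2.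

(* joint pmf of X, T and (Y, a(T)) *)
Definition PXT_YA P (x : X) (t : T) (ya : Y * A) : R :=
  if act t == ya.2 then PXYT P x ya.1 t else 0.

Definition expected_cost P : R := \sum_t \sum_x PX x * P x t * Delta (act t).

Definition expected_distortion P : R :=
  \sum_x \sum_y \sum_t PXYT P x y t * d x (recon t y).

Definition rate P : R := mutual_info (PXA P) + cond_mutual_info (PXT_YA P).

Definition feasible (D C : R) : set (X -> T -> R) :=
  [set P | [/\ cond_pmf P, expected_cost P <= C & expected_distortion P <= D]].

(* the rate-distortion-cost function; [+oo] when the constraints are
   infeasible *)
Definition RDC (D C : R) : \bar R :=
  ereal_inf [set (rate P)%:E | P in feasible D C].

(* Takes values in ]-oo, +oo] when [P], [QTY] and [QA] are pmfs. *)
Definition F (s m : R) P (QTY : T * Y -> R) (QA : A -> R) : \bar R :=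
  (\sum_y \sum_a (PYA P y a)%:E * elog2 ((PYA P y a)%:E / (QA a)%:E)
   - (\sum_x \sum_y \sum_t PXYT P x y t * log2 (W x (act t) y))%:E
   + \sum_x (PX x)%:E * kl_div (PTY_X P x) QTY
   - (s * \sum_x \sum_y \sum_t PXYT P x y t * d x (recon t y))%:E
   - (m * \sum_t \sum_x Delta (act t) * PX x * P x t)%:E)%E.

Definition F_minimizer (s m : R) P (QTY : T * Y -> R) (QA : A -> R) : Prop :=
  [/\ cond_pmf P, is_pmf QTY, is_pmf QA &
    forall P' QTY' QA', cond_pmf P' -> is_pmf QTY' -> is_pmf QA' ->
      (F s m P QTY QA <= F s m P' QTY' QA')%E].

Section Algorithm2.
Variables (s m beta : R) (QTY : T * Y -> R) (QA : A -> R).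
(* [PA a x] is P_{A|X}(a|x) *)
Implicit Types (PA : A -> X -> R) (mu : X -> R).

(* The exponent of the last factor is a real number or [-oo], so that [fine]
   is only applied to finite values. *)
Definition alpha_t (t : T) (x : X) : R :=
  QA (act t) * 2 `^ (m * Delta (act t)) *
  fine (exp2e (\sum_y (W x (act t) y)%:E *
          ((s * d x (recon t y))%:E + elog2 (QTY (t, y))%:E)))%E.

Definition alpha_a (a : A) (x : X) : R := \sum_(t | act t == a) alpha_t t x.

(* If no strategy has action [a], then [alpha_a a x = 0] and [g_map] sends the
   [a]-entries to 0, where they stay because [0 / 0 = 0] in a field. *)
Definition g_map mu PA : A -> X -> R := fun a x =>
  PA a x `^ beta *
  (2 `^ mu x * alpha_a a x /
     \prod_y (\sum_x' PX x' * W x' a y * PA a x') `^ W x a y) `^ (1 - beta).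

Definition fixpoint_iter mu PA (n : nat) : A -> X -> R := iter n (g_map mu) PA.

(* [limn u] is the limit of [u] when it exists, and a junk value otherwise *)
Definition fixpoint_limit mu PA : A -> X -> R := fun a x =>
  limn (fun n => fixpoint_iter mu PA n a x).

Fixpoint alg2_state (i : nat) : (X -> R) * (A -> X -> R) :=
  if i is j.+1 then
    let: (mu, PA) := alg2_state j in
    let PA' := fixpoint_limit mu PA in
    (fun x => mu x + (j.+1%:R)^-1 / PX x * (1 - \sum_a PA' a x), PA')
  else (fun=> 1, fun _ _ => (#|TT|%:R)^-1).

Definition alg2_mu (i : nat) : X -> R := (alg2_state i).1.
Definition alg2_PA (i : nat) : A -> X -> R := (alg2_state i).2.

Definition alg2_output : X -> T -> R := fun x t =>
  alpha_t t x / alpha_a (act t) x * limn (fun i => alg2_PA i (act t) x).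

Definition alg2_converges : Prop :=
  [/\ forall i a x,
        cvgn (fun n => fixpoint_iter (alg2_mu i) (alg2_PA i) n a x),
      forall x, cvgn (fun i => alg2_mu i x) &
      forall a x, cvgn (fun i => alg2_PA i a x)].

End Algorithm2.

Definition update_QA P (a : A) : R := \sum_x \sum_(t | act t == a) PX x * P x t.

Definition update_QTY P (ty : T * Y) : R :=
  \sum_x PX x * W x (act ty.1) ty.2 * P x ty.1.

(* [alg1_P 0] is the initialization; the pass with index [k >= 1] computes
   [alg1_QA k] and [alg1_QTY k] from [alg1_P k.-1] and then [alg1_P k] from
   them.  The values of [alg1_QA] and [alg1_QTY] at 0 play no role. *)
Fixpoint alg1_P (s m beta : R) (P0 : X -> T -> R) (k : nat) : X -> T -> R :=
  if k is j.+1 then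
    let P := alg1_P s m beta P0 j in
    alg2_output s m beta (update_QTY P) (update_QA P)
  else P0.

Definition alg1_QTY s m beta P0 (k : nat) : T * Y -> R :=
  update_QTY (alg1_P s m beta P0 k.-1).

Definition alg1_QA s m beta P0 (k : nat) : A -> R :=
  update_QA (alg1_P s m beta P0 k.-1).

End RateDistortionCost.

(* Main.v *)
(* For fixed [QTY], [QA] the KKT system of the minimisation over [P] reads, for
   each action [a] and in the variable [v = ln P_{A|X}(a|.)], as
   [v + K v = c + mu ln 2] where
   [K v x = \sum_y W(y|x,a) ln (\sum_x' PX x' W(y|x',a) e^(v x'))].
   The inner loop of Algorithm 2 iterates
   [v |-> beta v + (1 - beta) (c + mu ln 2 - K v)].  Since [K] is nonexpansive for
   the sup norm and the diagonal of its Jacobian is bounded below on boxes, this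
   is a contraction of a large invariant box.
   The total mass [n(mu) = \sum_a P_{A|X}(a|.)] is a monotone function of [mu]
   (because [v |-> v] and [K] are monotone with respect to [e^v]), strongly
   monotone and cocoercive on boxes.  The subgradient path stays bounded, since
   a large [mu x] forces [n(mu) x >= 1] and a very negative one [n(mu) x <= 1].
   The residual [1 - n(mu)] is then contracted by [1 - k theta_i] at step [i],
   so the increments of [mu] are summable and the residual tends to 0.
   Stationarity gives [F(P, Q_k) = const_k + V(P, P_k)] for every [P], with [V]
   a sum of two relative entropies, and the log-sum inequality gives
   [F(P, Q_(k+1)) - F(P, Q(P)) <= V(P, P_k)], where [Q_(k+1) = Q(P_k)] and
   [Q(P)] are the optimal [Q] for [P_k] and [P].  Hence, for a minimiser [P],
   [F(P_(k+1), Q_(k+1)) - min F <= V(P, P_k) - V(P, P_(k+1))], and this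
   telescopes. *)
Require Import Defs.
From mathcomp Require Import all_boot all_order all_algebra.
From mathcomp Require Import all_classical all_reals all_analysis.
From mathcomp Require Import ring lra.
Import Order.TTheory GRing.Theory Num.Theory.
Import numFieldNormedType.Exports.
Local Open Scope classical_set_scope.
Local Open Scope ring_scope.

Set Implicit Arguments.
Unset Strict Implicit.
Unset Printing Implicit Defensive.

(** * Elementary facts *)

Lemma pos_lower_bound (R : realType) (I : finType) (f : I -> R) :
  exists2 e : R, 0 < e & forall i, 0 < f i -> e <= f i.
Proof.
exists (\big[Order.min/1]_(i | 0 < f i) f i).
  by apply: lt_bigmin.
by move=> i fi; apply: bigmin_le_cond.
Qed.

Lemma upper_bound_fin (R : realType) (I : finType) (f : I -> R) :
  exists2 B : R, 0 <= B & forall i, `|f i| <= B.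
Proof.
exists (\sum_i `|f i|); first exact: sumr_ge0.
by move=> i; rewrite (bigD1 i)//= lerDl sumr_ge0.
Qed.

Lemma norm_bounds (R : realType) (u v : R) : `|u| <= v -> - v <= u /\ u <= v.
Proof. by rewrite ler_norml => /andP. Qed.

(** Convexity of [expR] between [0] and [u]: its tangent at [t * u] lies below it at both ends, and
    the two inequalities are added with weights [1 - t] and [t]. *)
Lemma expR_convex_mul (R : realType) (t u : R) : 0 <= t -> t <= 1 ->
  expR (t * u) <= 1 + t * (expR u - 1).
Proof.
move=> t0 t1.
have -> : expR u = expR (t * u) * expR ((1 - t) * u).
  by rewrite -expRD -mulrDl addrC subrK mul1r.
have E0 := expR_gt0 (t * u).
have h1 : 1 >= expR (t * u) * (1 - t * u).
  rewrite -[leRHS]expR0 -(subrr (t * u)) expRD.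
  by rewrite ler_pM2l//; exact: (expR_ge1Dx (- (t * u))).
have h2 : expR (t * u) * expR ((1 - t) * u) >= expR (t * u) * (1 + (1 - t) * u).
  by rewrite ler_pM2l//; exact: expR_ge1Dx.
have g1 : 0 <= (1 - t) * (1 - expR (t * u) * (1 - t * u)).
  by rewrite mulr_ge0// subr_ge0.
have g2 : 0 <= t * (expR (t * u) * expR ((1 - t) * u) -
    expR (t * u) * (1 + (1 - t) * u)).
  by rewrite mulr_ge0// subr_ge0.
move: g1 g2; set E := expR _; set F := expR _ => g1 g2.
rewrite -subr_ge0; apply: le_trans (addr_ge0 g1 g2) _.
by rewrite le_eqVlt; apply/orP; left; apply/eqP; ring.
Qed.

Lemma expR_sub_le (R : realType) (u v : R) :
  expR u - expR v <= expR u * (u - v).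
Proof.
have -> : expR v = expR u * expR (v - u) by rewrite -expRD addrC subrK.
rewrite -{1}[expR u]mulr1 -mulrBr ler_pM2l ?expR_gt0//.
have h : 1 + (v - u) <= expR (v - u) by exact: expR_ge1Dx.
lra.
Qed.

(** Strong monotonicity on a half-line, from the tangent at the smaller of the two points. *)
Lemma expR_mono_ge (R : realType) (L u v : R) : L <= u -> L <= v ->
  expR L * (u - v) ^+ 2 <= (u - v) * (expR u - expR v).
Proof.
wlog uv : u v / v <= u.
  move=> H Lu Lv; have [/H|/ltW /H] := leP v u; first exact.
  by move=> /(_ Lv Lu); lra.
move=> Lu Lv; have h1 := expR_sub_le v u.
have h2 : expR L * (u - v) <= expR v * (u - v).
  by rewrite ler_wpM2r ?subr_ge0// ler_expR.
by rewrite expr2 mulrCA ler_wpM2l ?subr_ge0//; lra.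
Qed.

(** Cocoercivity on a half-line, from the tangent at the larger of the two points. *)
Lemma expR_mono_le (R : realType) (U u v : R) : u <= U -> v <= U ->
  (expR u - expR v) ^+ 2 <= expR U * ((u - v) * (expR u - expR v)).
Proof.
wlog uv : u v / v <= u.
  move=> H Lu Lv; have [/H|/ltW /H] := leP v u; first exact.
  by move=> /(_ Lv Lu); lra.
move=> Lu Lv; have h1 := expR_sub_le u v.
have h2 : expR u <= expR U by rewrite ler_expR.
have h3 : expR v <= expR u by rewrite ler_expR.
have h4 : expR u - expR v <= expR U * (u - v).
  by apply: (le_trans h1); rewrite ler_wpM2r// subr_ge0.
by rewrite expr2 mulrA ler_wpM2r// subr_ge0.
Qed.

Lemma expR_mono_ge0 (R : realType) (u v : R) : 0 <= (u - v) * (expR u - expR v).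
Proof.
have [uv|uv] := leP v u.
  by rewrite mulr_ge0// subr_ge0// ler_expR.
by rewrite nmulr_rge0 ?subr_lt0// subr_le0 ler_expR ltW.
Qed.

Lemma ln_mono_ge0 (R : realType) (u v : R) : 0 < u -> 0 < v ->
  0 <= (u - v) * (ln u - ln v).
Proof.
move=> u0 v0; have := expR_mono_ge0 (ln u) (ln v).
by rewrite !lnK// mulrC.
Qed.

Lemma cvg_geometric_steps (R : realType) (u : nat -> R) (k E : R) :
  0 <= k -> k < 1 ->
  (forall n, `|u n.+1 - u n| <= k ^+ n * E) -> cvgn u.
Proof.
move=> k0 k1 H.
have -> : u = (fun n => u 0%N + series (telescope u) n).
  by apply/funext => n; exact: eq_sum_telescope.
apply: is_cvgD; first exact: is_cvg_cst.
apply: normed_cvg; apply: (series_le_cvg (v_ := geometric E k)).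
- by move=> n /=.
- move=> n /=; rewrite mulr_ge0 ?exprn_ge0//.
  by have := le_trans (normr_ge0 _) (H 0%N); rewrite expr0 mul1r.
- by move=> n /=; rewrite mulrC; exact: H.
- by apply: is_cvg_geometric_series; rewrite ger0_norm.
Qed.

Lemma damped_fixed_eq (R : realType) (beta a b c : R) : beta < 1 ->
  a = beta * a + (1 - beta) * (c - b) -> a + b = c.
Proof.
move=> b1 h; have b0 : 1 - beta != 0 by rewrite gt_eqF// subr_gt0.
by apply: (mulfI b0); lra.
Qed.

Lemma cvg_sumr (R : realType) (T : Type) (G : set_system T) {FG : Filter G}
    (I : finType) (P : pred I) (f : I -> T -> R) (l : I -> R) :
  (forall i, P i -> f i x @[x --> G] --> l i) ->
  \sum_(i | P i) f i x @[x --> G] --> \sum_(i | P i) l i.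
Proof. by apply: cvg_big; exact: add_continuous. Qed.

Lemma pmf_inhabited (R : realType) (I : finType) (p : I -> R) :
  is_pmf p -> exists i : I, True.
Proof.
move=> [_ p1]; apply: contrapT => noI; move: p1; rewrite big1 => [/eqP|i _].
  by rewrite eq_sym oner_eq0.
by exfalso; apply: noI; exists i.
Qed.

(** * The inner fixed-point iteration *)

Section Channel.
Context {R : realType} {X Y : finType}.
Variables (PX : X -> R) (W : X -> Y -> R).
Hypotheses (PX_pmf : is_pmf PX) (PX_gt0 : forall x, 0 < PX x).
Hypothesis W_pmf : cond_pmf W.
Implicit Types v w c : X -> R.

(** For the channel of one action [a] and [v = ln P_{A|X}(a|.)] this is [P_{Y,A}(y,a)]. *)
Definition out_weight v y := \sum_x PX x * W x y * expR (v x).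

(** The operator [K] for one action. Where [out_weight v y] is [0], so is the coefficient
    [W x y]. *)
Definition log_avg v x := \sum_y W x y * ln (out_weight v y).

Let W_ge0 x y : 0 <= W x y. Proof. by case: (W_pmf x). Qed.
Let W_sum x : \sum_y W x y = 1. Proof. by case: (W_pmf x). Qed.

Lemma weight_ge0 v x y : 0 <= PX x * W x y * expR (v x).
Proof. by rewrite !mulr_ge0 ?expR_ge0// ltW. Qed.

Lemma out_weight_ge v x y : PX x * W x y * expR (v x) <= out_weight v y.
Proof.
by rewrite /out_weight (bigD1 x)//= lerDl sumr_ge0// => z _; exact: weight_ge0.
Qed.

Lemma out_weight_gt0 v x y : 0 < W x y -> 0 < out_weight v y.
Proof.
move=> Wxy; apply: lt_le_trans (out_weight_ge v x y).
by rewrite !mulr_gt0 ?expR_gt0.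
Qed.

Lemma W_le1 x y : W x y <= 1.
Proof.
rewrite -(W_sum x) (bigD1 y)//= lerDl sumr_ge0// => z _.
Qed.

Lemma PXW_sum_le1 y : \sum_x PX x * W x y <= 1.
Proof.
case: PX_pmf => _ <-; apply: ler_sum => x _.
by rewrite -[leRHS]mulr1 ler_pM2l// W_le1.
Qed.

Definition avg_defect x := - (ln (PX x) + \sum_y W x y * ln (W x y)).

(** Only the summand [x] of each [out_weight v y] is kept; [avg_defect] collects the logarithms of
    its factors [PX x] and [W x y]. *)
Lemma log_avg_ge v x : v x - avg_defect x <= log_avg v x.
Proof.
have -> : v x - avg_defect x =
    \sum_y W x y * (v x + ln (PX x) + ln (W x y)).
  under eq_bigr do rewrite mulrDr.
  by rewrite big_split/= -mulr_suml W_sum mul1r /avg_defect opprK addrA.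
apply: ler_sum => y _.
have := W_ge0 x y; rewrite le_eqVlt => /predU1P[<-|Wxy].
  by rewrite !mul0r.
rewrite ler_pM2l//.
have -> : v x + ln (PX x) + ln (W x y) = ln (PX x * W x y * expR (v x)).
  by rewrite !lnM ?posrE ?mulr_gt0 ?expR_gt0// expRK; ring.
rewrite ler_ln ?posrE ?mulr_gt0 ?expR_gt0//; first exact: out_weight_ge.
exact: out_weight_gt0 Wxy.
Qed.

Lemma log_avg_le v (U : R) : (forall x, v x <= U) -> forall x, log_avg v x <= U.
Proof.
move=> vU x; rewrite -[leRHS]mul1r -(W_sum x) mulr_suml; apply: ler_sum => y _.
have := W_ge0 x y; rewrite le_eqVlt => /predU1P[<-|Wxy].
  by rewrite !mul0r.
rewrite ler_pM2l// -[leRHS]expRK ler_ln ?posrE ?expR_gt0//; last first.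
  exact: out_weight_gt0 Wxy.
apply: (@le_trans _ _ (\sum_x PX x * W x y * expR U)).
  by apply: ler_sum => z _; rewrite ler_wpM2l ?ler_expR// mulr_ge0// ltW.
by rewrite -mulr_suml -[leRHS]mul1r ler_wpM2r ?expR_ge0// PXW_sum_le1.
Qed.

(** Raising [v] by [E] puts it above [w], with an excess [v x - w x + E] at [x]. As the summand [x]
    makes up at least a fraction [t] of each relevant [out_weight w y], convexity of [expR] passes
    at least [t] times this excess on to the logarithm. The value [t = 0] gives nonexpansiveness, a
    positive [t] gives the contraction. *)
Lemma log_avg_diff_ge v w (E t : R) x :
  0 <= t -> t <= 1 ->
  (forall z, - E <= v z - w z) ->
  (forall y, 0 < W x y -> t * out_weight w y <= PX x * W x y * expR (w x)) ->
  - E + t * (v x - w x + E) <= log_avg v x - log_avg w x.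
Proof.
move=> t0 t1 vw tP; rewrite /log_avg -sumrB.
rewrite -[leLHS]mul1r -(W_sum x) mulr_suml; apply: ler_sum => y _.
have := W_ge0 x y; rewrite le_eqVlt => /predU1P[<-|Wxy].
  by rewrite !mul0r subr0.
rewrite -mulrBr ler_pM2l//.
set e := v x - w x + E.
have qv := out_weight_gt0 v Wxy; have qw := out_weight_gt0 w Wxy.
rewrite lerBrDr -[leLHS]expRK ler_ln ?posrE ?expR_gt0//.
rewrite !expRD lnK ?posrE//.
have h1 : expR (- E) * (out_weight w y +
    PX x * W x y * expR (w x) * (expR e - 1)) <= out_weight v y.
  have -> : out_weight w y + PX x * W x y * expR (w x) * (expR e - 1) =
    PX x * W x y * expR (w x + e) +
      \sum_(z | z != x) PX z * W z y * expR (w z).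
    by rewrite /out_weight (bigD1 x)//= expRD; ring.
  rewrite /out_weight [leRHS](bigD1 x)//= mulrDr mulr_sumr lerD//.
    rewrite mulrCA -expRD ler_wpM2l ?mulr_ge0 ?(ltW (PX_gt0 _))//.
    by rewrite ler_expR /e; lra.
  apply: ler_sum => z _;
    rewrite mulrCA -expRD ler_wpM2l ?mulr_ge0 ?(ltW (PX_gt0 _))//.
  by rewrite ler_expR; have := vw z; lra.
apply: le_trans h1; rewrite -mulrA ler_pM2l ?expR_gt0//.
have e0 : 0 <= expR e - 1.
  by rewrite subr_ge0 -expR0 ler_expR /e; have := vw x; lra.
have h2 := expR_convex_mul e t0 t1; have h3 := tP y Wxy.
apply: le_trans (ler_wpM2r (ltW qw) h2) _.
by rewrite [leLHS]mulrC mulrDr mulr1 lerD2l mulrCA mulrA ler_wpM2r.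
Qed.

(** Exchanging the sums leaves one product per output [y], of a difference of output weights and the
    difference of their logarithms, and [ln] is increasing. An output that no [x] can produce has
    both weights equal to [0]. *)
Lemma log_avg_monotone v w :
  0 <= \sum_x PX x * ((expR (v x) - expR (w x)) * (log_avg v x - log_avg w x)).
Proof.
have -> : \sum_x PX x * ((expR (v x) - expR (w x)) *
      (log_avg v x - log_avg w x)) =
    \sum_y (out_weight v y - out_weight w y) *
      (ln (out_weight v y) - ln (out_weight w y)).
  under [RHS]eq_bigr => y _ do rewrite /out_weight -sumrB mulr_suml.
  rewrite [RHS]exchange_big; apply: eq_bigr => x _ /=.
  rewrite /log_avg -sumrB !mulr_sumr; apply: eq_bigr => y _.
  by rewrite /out_weight; ring.
apply: sumr_ge0 => y _.
have [/existsP[x Wxy]|/existsPn noW] := boolP [exists x, 0 < W x y].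
  by apply: ln_mono_ge0; apply: out_weight_gt0 Wxy.
have q0 u : out_weight u y = 0.
  rewrite /out_weight big1// => x _.
  have /eqP -> : W x y == 0 by rewrite eq_le W_ge0 leNgt noW.
  by rewrite mulr0 mul0r.
by rewrite !q0 !subrr mul0r.
Qed.

Definition damped (beta : R) c v : X -> R := fun x =>
  beta * v x + (1 - beta) * (c x - log_avg v x).

(* The interval [[- r, (1 - beta) r]] is invariant for large [r]: its upper end
   is governed by [log_avg_ge] and its lower end by [log_avg_le]. *)
Lemma damped_box (beta : R) c v0 : 0 < beta -> beta < 1 -> exists r : R,
  (forall x, - r <= v0 x <= (1 - beta) * r) /\
  (forall v, (forall x, - r <= v x <= (1 - beta) * r) ->
     forall x, - r <= damped beta c v x <= (1 - beta) * r).
Proof.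
move=> beta_gt0 beta_lt1; have [V V0 VP] := upper_bound_fin v0.
have [C C0 CP] := upper_bound_fin c.
have [k k0 kP] := upper_bound_fin avg_defect.
(* With this radius [S = beta * (1 - beta) * r], so [S] is at most both [beta * r] and
   [(1 - beta) * r]. *)
pose S := C + k + V; exists (S / (beta * (1 - beta))); set r := S / _.
have bb : 0 < beta * (1 - beta) by rewrite mulr_gt0// subr_gt0.
have rS : beta * (1 - beta) * r = S by rewrite mulrC divfK// gt_eqF.
have S0 : 0 <= S by rewrite !addr_ge0.
have r0 : 0 <= r by rewrite divr_ge0// ltW.
have r1 : S <= beta * r.
  by rewrite -rS -mulrA ler_pM2l// ler_piMl//; lra.
have r2 : S <= (1 - beta) * r.
  by rewrite -rS [beta * _]mulrC -mulrA ler_wpM2l ?ler_piMl//; lra.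
split=> [x|v vP x].
  by have [a b] := norm_bounds (VP x); rewrite /S in r1 r2; apply/andP; split;
    lra.
have vU z : v z <= (1 - beta) * r by have /andP[] := vP z.
have h1 := log_avg_ge v x; have h2 := log_avg_le vU x.
have /andP[a b] := vP x.
have [c1 c2] := norm_bounds (CP x).
have [k1 k2] := norm_bounds (kP x).
rewrite /damped /S in r1 r2 *.
have b0 : 0 < 1 - beta by lra.
apply/andP; split.
  have : (1 - beta) * (c x - log_avg v x) >= (1 - beta) * (- C - (1 - beta) * r).
    by rewrite ler_pM2l//; lra.
  have : (1 - beta) * C <= (1 - beta) * (beta * r) by rewrite ler_pM2l//; lra.
  nra.
have h3 : (1 - beta) * (c x - log_avg v x) <= (1 - beta) * (C + k - v x).
  by rewrite ler_pM2l//; lra.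
(* By [h3] the new value is at most [(2 * beta - 1) * v x + (1 - beta) * (C + k)]; the sign of
   [2 * beta - 1] decides which end of the box has to bound [v x]. *)
have [h|h] := leP (1 / 2) beta.
  have : (1 - beta) * (C + k) <= (1 - beta) * ((1 - beta) * r)
    by rewrite ler_pM2l//; lra.
  have : (2 * beta - 1) * v x <= (2 * beta - 1) * ((1 - beta) * r)
    by rewrite ler_wpM2l//; lra.
  have : 0 <= (1 - beta) * ((1 - beta) * r)
    by do 2 (apply: mulr_ge0; first lra).
  nra.
have : (1 - beta) * (C + k) <= beta * r.
  by apply: le_trans (_ : C + k <= _); [rewrite ler_piMl ?addr_ge0//; lra|lra].
have : (1 - 2 * beta) * (- v x) <= (1 - 2 * beta) * r by rewrite ler_pM2l//;
  lra.
nra.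
Qed.

(* [t] bounds from below the diagonal of the Jacobian of [log_avg] on the box;
   [t <= beta] keeps the coefficient [beta - (1 - beta) t] of [v x - w x]
   nonnegative. *)
Lemma damped_contraction (beta : R) c (r : R) : 0 < beta -> beta < 1 ->
  exists k : R, [/\ 0 <= k, k < 1 &
  forall v w E, (forall x, - r <= v x <= (1 - beta) * r) ->
    (forall x, - r <= w x <= (1 - beta) * r) ->
    (forall x, `|v x - w x| <= E) ->
    forall x, `|damped beta c v x - damped beta c w x| <= k * E].
Proof.
move=> beta_gt0 beta_lt1.
have [e e0 eP] :=
  pos_lower_bound (fun xy : X * Y => PX xy.1 * W xy.1 xy.2).
(* On the box, [e * expR (- r)] is a lower bound of every positive summand of [out_weight], and
   [expR ((1 - beta) * r)] is an upper bound of the whole sum. *)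
pose t := Num.min beta (e * expR (- r) / expR ((1 - beta) * r)).
have t0 : 0 < t by rewrite lt_min beta_gt0/= !mulr_gt0 ?invr_gt0 ?expR_gt0.
have tb : t <= beta by rewrite ge_min lexx.
have t1 : t <= 1 by apply: le_trans tb (ltW beta_lt1).
(* The factor is the sum of the coefficient [beta - (1 - beta) * t] of [v x - w x] and the
   coefficient [(1 - beta) * (1 - t)] of [E] that [log_avg_diff_ge] leaves. *)
exists (1 - 2 * (1 - beta) * t); split.
- nra.
- nra.
have main v w E : (forall x, - r <= w x <= (1 - beta) * r) ->
    (forall x, `|v x - w x| <= E) ->
    forall x, damped beta c v x - damped beta c w x <=
      (1 - 2 * (1 - beta) * t) * E.
  move=> wP vwE x.
  have vwE' z : - E <= v z - w z by have [] := norm_bounds (vwE z).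
  have tP y : 0 < W x y ->
      t * out_weight w y <= PX x * W x y * expR (w x).
    move=> Wxy; apply: (@le_trans _ _ (e * expR (- r))); last first.
      apply: ler_pM; rewrite ?expR_ge0 ?(ltW e0)//.
        by apply: (eP (x, y)); rewrite mulr_gt0.
      by rewrite ler_expR; have /andP[] := wP x.
    have qle : out_weight w y <= expR ((1 - beta) * r).
      apply: (@le_trans _ _ (\sum_x PX x * W x y * expR ((1 - beta) * r))).
        apply: ler_sum => z _; rewrite ler_wpM2l ?ler_expR//.
          by rewrite mulr_ge0// ltW.
        by have /andP[] := wP z.
      by rewrite -mulr_suml ler_piMl ?expR_ge0// PXW_sum_le1.
    apply: le_trans (ler_wpM2l (ltW t0) qle) _.
    by rewrite -ler_pdivlMr ?expR_gt0// ge_min lexx orbT.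
  have h := log_avg_diff_ge (ltW t0) t1 vwE' tP.
  have : (1 - beta) * (log_avg v x - log_avg w x) >=
      (1 - beta) * (- E + t * (v x - w x + E)) by rewrite ler_pM2l ?subr_gt0.
  have : (beta - (1 - beta) * t) * (v x - w x) <= (beta - (1 - beta) * t) * E.
    apply: ler_wpM2l; first by nra.
    by have [] := norm_bounds (vwE x).
  rewrite /damped; nra.
move=> v w E vP wP vwE x; rewrite ler_norml; apply/andP; split;
  last exact: main.
rewrite lerNl opprB; apply: main => // z; by rewrite distrC.
Qed.

Lemma out_weight_cvg (vn : nat -> X -> R) v :
  (forall x, vn ^~ x @ \oo --> v x) ->
  forall y, (fun n => out_weight (vn n) y) @ \oo --> out_weight v y.
Proof.
move=> vnP y; rewrite /out_weight; apply: cvg_sumr => x _.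
have h := @continuous_cvg _ _ _ _ _ _ expR _ (@continuous_expR R (v x)) (vnP x).
by apply: cvgMl_tmp; exact: h.
Qed.

Lemma log_avg_cvg (vn : nat -> X -> R) v :
  (forall x, vn ^~ x @ \oo --> v x) ->
  forall x, (fun n => log_avg (vn n) x) @ \oo --> log_avg v x.
Proof.
move=> vnP x; rewrite /log_avg; apply: cvg_sumr => y _.
have := W_ge0 x y; rewrite le_eqVlt => /predU1P[<-|Wxy].
  by under eq_fun do rewrite mul0r; rewrite mul0r; exact: cvg_cst.
have h := @continuous_cvg _ _ _ _ _ _ (@ln R) _
  (continuous_ln (out_weight_gt0 v Wxy)) (@out_weight_cvg _ _ vnP y).
by apply: cvgMl_tmp; exact: h.
Qed.

(** Contraction on an invariant box makes the steps geometric. The limit is fixed by [damped], and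
    since [beta < 1] it solves the undamped equation, in which [beta] no longer occurs. *)
Lemma damped_iter_cvg (beta : R) c v0 : 0 < beta -> beta < 1 -> exists v,
  (forall x, (fun n => iter n (damped beta c) v0 x) @ \oo --> v x) /\
  (forall x, v x + log_avg v x = c x).
Proof.
move=> beta_gt0 beta_lt1; have [r [r0 rP]] := damped_box c v0 beta_gt0 beta_lt1.
have [k [k0 k1 kP]] := damped_contraction c r beta_gt0 beta_lt1.
pose vn n := iter n (damped beta c) v0.
have vnP n : forall x, - r <= vn n x <= (1 - beta) * r.
  by elim: n => [|n IH] //=; apply: rP.
have [E E0 EP] := upper_bound_fin (fun x => vn 1%N x - vn 0%N x).
have step n : forall x, `|vn n.+1 x - vn n x| <= k ^+ n * E.
  elim: n => [|n IH] x; first by rewrite expr0 mul1r; exact: EP.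
  by rewrite exprS -mulrA; apply: kP => //; exact: (vnP n.+1).
have cv x : cvgn (vn ^~ x).
  by apply: (cvg_geometric_steps k0 k1 (E := E)) => n; exact: step.
exists (fun x => limn (vn ^~ x)); split=> [x|x]; first exact: cv.
set v := fun x => limn (vn ^~ x).
have vnv z : vn ^~ z @ \oo --> v z by exact: cv.
have h1 : (fun n => vn n.+1 x) @ \oo --> v x by rewrite (cvg_shiftS (vn ^~ x)).
have h2 : (fun n => vn n.+1 x) @ \oo --> damped beta c v x.
  rewrite /vn /=; rewrite /damped; apply: cvgD; first by apply: cvgMl_tmp;
    exact: vnv.
  by apply: cvgMl_tmp; apply: cvgB; [exact: cvg_cst|exact: log_avg_cvg].
have : v x = damped beta c v x by apply: cvg_unique h1 h2; exact: Rhausdorff.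
exact: damped_fixed_eq.
Qed.

End Channel.

(** * The subgradient loop *)

(** Cauchy-Schwarz against a constant family, read off from the nonnegative double sum of
    [(f i - f j) ^+ 2]. *)
Lemma sqr_sum_le (R : realType) (I : finType) (f : I -> R) :
  (\sum_i f i) ^+ 2 <= #|I|%:R * \sum_i f i ^+ 2.
Proof.
have h : 0 <= \sum_i \sum_j (f i - f j) ^+ 2.
  by apply: sumr_ge0 => i _; apply: sumr_ge0 => j _; exact: sqr_ge0.
have E1 : \sum_i \sum_j (f i - f j) ^+ 2 =
    \sum_i \sum_(j : I) f i ^+ 2 + \sum_(i : I) \sum_j f j ^+ 2 -
    2 * \sum_i \sum_j f i * f j.
  rewrite mulr_sumr -big_split/= -sumrB; apply: eq_bigr => i _.
  by rewrite mulr_sumr -big_split/= -sumrB; apply: eq_bigr => j _; ring.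
have E2 : \sum_i \sum_(j : I) f i ^+ 2 = #|I|%:R * \sum_i f i ^+ 2.
  rewrite mulr_sumr; apply: eq_bigr => i _.
  by rewrite sumr_const mulr_natl; congr (_ *+ _); apply: eq_card.
have E3 : \sum_(i : I) \sum_j f j ^+ 2 = #|I|%:R * \sum_i f i ^+ 2.
  by rewrite exchange_big E2.
have E4 : \sum_i \sum_j f i * f j = (\sum_i f i) ^+ 2.
  by rewrite expr2 mulr_suml; apply: eq_bigr => i _; rewrite mulr_sumr.
by move: h; rewrite E1 E2 E3 E4; lra.
Qed.

(** Write [u = (u + w) - w]. From [N] on, both [u + w] and [w] are nonincreasing; the first is
    bounded below because [u - w] is nondecreasing and [w] is nonnegative. *)
Lemma cvgn_dominated_steps (R : realType) (N : nat) (u w : nat -> R) :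
  (forall i, 0 <= w i) ->
  (forall i, (N <= i)%N -> `|u i.+1 - u i| <= w i - w i.+1) -> cvgn u.
Proof.
move=> w0 H.
have noninc (f : nat -> R) (lb : R) : (forall i, (N <= i)%N -> f i.+1 <= f i) ->
    (forall i, (N <= i)%N -> lb <= f i) -> cvgn f.
  move=> fd fl; apply/(cvg_ex _).
  suff /cvg_ex[l fl'] : cvgn (fun i => f (i + N)%N).
    by exists l; rewrite -(cvg_shiftn N f).
  apply: nonincreasing_is_cvgn.
    by apply/nonincreasing_seqP => n; rewrite addSn; apply: fd;
      rewrite leq_addl.
  by exists lb => _ [n _ <-]; apply: fl; rewrite leq_addl.
have wd i : (N <= i)%N -> w i.+1 <= w i.
  by move=> /H h; rewrite -subr_ge0 (le_trans _ h).
have -> : u = (fun i => (u i + w i) - w i) by apply/funext => i; rewrite addrK.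
apply: is_cvgB; last by apply: (noninc w 0).
apply: (noninc _ (u N - w N)).
  by move=> i /H /norm_bounds[_ h]; lra.
move=> i; elim: i => [|i IH]; first by rewrite leqn0 => /eqP ->;
  have := w0 0%N; lra.
rewrite leq_eqVlt => /predU1P[<-|]; first by have := w0 N; lra.
rewrite ltnS => Ni.
have h j : (N <= j)%N -> u N - w N <= u j - w j.
  elim: j => [|j IHj]; first by rewrite leqn0 => /eqP ->.
  rewrite leq_eqVlt => /predU1P[<-//|]; rewrite ltnS => Nj.
  by have [h1 _] := norm_bounds (H _ Nj); have := IHj Nj; lra.
by have := h _ (leqW Ni); have := w0 i.+1; lra.
Qed.

(** Telescoping would bound the partial sums of the harmonic series from [N] on by [w N / e]. *)
Lemma harmonic_not_dominated (R : realType) (N : nat) (w : nat -> R) (e : R) :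
  0 < e -> (forall i, 0 <= w i) ->
  ~ (forall i, (N <= i)%N -> e * harmonic i <= w i - w i.+1).
Proof.
move=> e0 w0 H; apply: (@dvg_harmonic R); rewrite -(is_cvg_series_restrict N).
apply: nondecreasing_is_cvgn.
  apply/nondecreasing_seqP => n /=.
  have [Nn|nN] := leqP N n; first by rewrite big_nat_recr//= lerDl harmonic_ge0.
  by rewrite !big_geq// ltnW.
exists (e^-1 * w N) => _ [n _ <-] /=.
rewrite ler_pdivlMl// mulr_sumr.
suff h : (N <= n)%N -> \sum_(N <= k < n) e * harmonic k <= w N - w n.
  have [Nn|nN] := leqP N n; last by rewrite big_geq// ltnW.
  by have := h Nn; have := w0 n; lra.
elim: n => [|n IH]; first by rewrite leqn0 => /eqP ->; rewrite big_geq// subrr.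
rewrite leq_eqVlt => /predU1P[->|]; first by rewrite big_geq// subrr.
rewrite ltnS => Nn; rewrite big_nat_recr// -[w N](subrK (w n)) -addrA.
by apply: lerD; [exact: IH|exact: H].
Qed.

Lemma squeeze_sqr (R : realType) (u z : nat -> R) (l : R) :
  (forall i, (u i - l) ^+ 2 <= z i) -> z @ \oo --> 0 -> u @ \oo --> l.
Proof.
move=> H z0; apply/cvgrPdist_lt => e e0.
have e2 : 0 < e ^+ 2 by rewrite exprn_gt0.
move/cvgrPdist_lt : z0 => /(_ _ e2); apply: filterS => n.
rewrite sub0r normrN => h.
rewrite distrC -(@ltr_pXn2r _ 2)// ?nnegrE ?normr_ge0 ?(ltW e0)//.
rewrite real_normK ?num_real//; apply: le_lt_trans (H n) _.
exact: le_lt_trans (ler_norm _) h.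
Qed.

(** * The KKT system: solvability, bounds and monotonicity in the multiplier *)

Section Dual.
Context {R : realType} {X Y A : finType}.
Variables (PX : X -> R) (W : X -> A -> Y -> R) (c : A -> X -> R) (S : pred A).
Hypotheses (PX_pmf : is_pmf PX) (PX_gt0 : forall x, 0 < PX x).
Hypothesis W_pmf : forall x a, is_pmf (W x a).
Implicit Types (l : X -> R) (v : A -> X -> R).

Local Notation K a := (log_avg PX (fun x y => W x a y)).

Definition kkt l v := forall a, S a -> forall x,
  v a x + K a (v a) x = c a x + l x.

Definition total_mass v x := \sum_(a | S a) expR (v a x).

Lemma kkt_exists l : exists v, kkt l v.
Proof.
have H a := damped_iter_cvg PX_pmf PX_gt0 (W_pmf ^~ a)
  (fun x => c a x + l x) (fun=> 0) (divr_gt0 ltr01 (ltr0n R 2)).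
have h2 : (1 / 2%:R : R) < 1 by lra.
have {}H a := H a h2.
have [v vP] := choice H.
by exists v => a _ x; case: (vP a) => _; exact.
Qed.

(** By [log_avg_ge] the left side of the system is at least [2 * v a x] minus a constant, whence the
    slope [1 / 2] of the upper bound. This bound, fed into [log_avg_le], bounds [K] from above and
    so [v] from below. *)
Lemma kkt_bound : exists2 B : R, 0 <= B & forall l v, kkt l v ->
  (forall a x, S a -> v a x <= B + l x / 2) /\
  (forall M, (forall x, l x <= M) ->
     forall a x, S a -> l x - M / 2 - 2 * B <= v a x).
Proof.
have [B1 B10 B1P] := upper_bound_fin (fun ax : A * X => c ax.1 ax.2).
have [B2 B20 B2P] := upper_bound_fin
  (fun ax : A * X => avg_defect PX (fun x y => W x ax.1 y) ax.2).
exists (B1 + B2) => [|l v lv]; first exact: addr_ge0.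
have up a x : S a -> v a x <= B1 + B2 + l x / 2.
  move=> Sa; have := lv a Sa x.
  have := log_avg_ge PX_gt0 (W_pmf ^~ a) (v a) x.
  have /= [_ h1] := norm_bounds (B1P (a, x)).
  have /= [_ h2] := norm_bounds (B2P (a, x)).
  lra.
split=> // M lM a x Sa; have := lv a Sa x.
have vU z : v a z <= B1 + B2 + M / 2 by have := up a z Sa; have := lM z; lra.
have := log_avg_le PX_pmf PX_gt0 (W_pmf ^~ a) vU x.
have /= [h1 _] := norm_bounds (B1P (a, x)).
lra.
Qed.

(** The difference of the two systems is paired with [PX x * (expR (v a x) - expR (v' a x))] and
    summed. The part coming from [K] is nonnegative by [log_avg_monotone]; the part coming from [v]
    is the left side. *)
Lemma kkt_monotone l l' v v' : kkt l v -> kkt l' v' ->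
  \sum_(a | S a) \sum_x
    PX x * ((v a x - v' a x) * (expR (v a x) - expR (v' a x))) <=
  \sum_x PX x * ((l x - l' x) * (total_mass v x - total_mass v' x)).
Proof.
move=> lv lv'; rewrite -subr_ge0.
have -> : \sum_x PX x * ((l x - l' x) * (total_mass v x - total_mass v' x)) =
    \sum_(a | S a) \sum_x
      PX x * ((l x - l' x) * (expR (v a x) - expR (v' a x))).
  rewrite [RHS]exchange_big; apply: eq_bigr => x _ /=.
  by rewrite -!mulr_sumr /total_mass -sumrB.
rewrite -sumrB; apply: sumr_ge0 => a Sa.
apply: le_trans (log_avg_monotone PX_gt0 (W_pmf ^~ a) (v a) (v' a)) _.
rewrite -sumrB; apply: ler_sum => x _.
have <- : v a x + K a (v a) x - c a x = l x by rewrite (lv a Sa x); ring.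
have <- : v' a x + K a (v' a) x - c a x = l' x by rewrite (lv' a Sa x); ring.
by rewrite le_eqVlt; apply/orP; left; apply/eqP; ring.
Qed.

Lemma PX_le1 x : PX x <= 1.
Proof.
case: PX_pmf => _ <-; rewrite (bigD1 x)//= lerDl sumr_ge0// => z _; exact: ltW.
Qed.

Lemma kkt_gap_ge l l' v v' a x : kkt l v -> kkt l' v' -> S a ->
  PX x * ((v a x - v' a x) * (expR (v a x) - expR (v' a x)))
  <= \sum_x PX x * ((l x - l' x) * (total_mass v x - total_mass v' x)).
Proof.
move=> lv lv' Sa; apply: le_trans (kkt_monotone lv lv').
have ge0 b z : 0 <= PX z * ((v b z - v' b z) * (expR (v b z) - expR (v' b z))).
  by rewrite mulr_ge0 ?expR_mono_ge0// ltW.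
rewrite (bigD1 a)//= (bigD1 x)//= -addrA lerDl addr_ge0//.
  exact: sumr_ge0.
by apply: sumr_ge0 => b _; exact: sumr_ge0.
Qed.

(** Cauchy-Schwarz over the actions gives the factor [#|A|], and [expR_mono_le] turns each squared
    difference of exponentials into a term bounded by [kkt_monotone]. *)
Lemma kkt_cocoercive l l' v v' (U : R) : kkt l v -> kkt l' v' ->
  (forall a x, S a -> v a x <= U) -> (forall a x, S a -> v' a x <= U) ->
  \sum_x PX x * (total_mass v x - total_mass v' x) ^+ 2 <=
  #|A|%:R * expR U *
    \sum_x PX x * ((l x - l' x) * (total_mass v x - total_mass v' x)).
Proof.
move=> lv lv' vU v'U.
apply: (@le_trans _ _ (#|A|%:R * expR U * \sum_(a | S a) \sum_x
    PX x * ((v a x - v' a x) * (expR (v a x) - expR (v' a x))))); last first.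
  by rewrite ler_wpM2l ?kkt_monotone// mulr_ge0 ?expR_ge0.
rewrite exchange_big mulr_sumr; apply: ler_sum => x _ /=.
rewrite -mulr_sumr [leRHS]mulrCA ler_pM2l//.
rewrite /total_mass -sumrB big_mkcond/=.
apply: le_trans (sqr_sum_le _) _.
rewrite -mulrA ler_wpM2l// mulr_sumr [leRHS]big_mkcond/=.
apply: ler_sum => a _; case: ifPn => Sa; last by rewrite expr0n.
by apply: expR_mono_le; [exact: vU|exact: v'U].
Qed.

Lemma log_avg_lipschitz a (v w : X -> R) (E : R) :
  (forall x, `|v x - w x| <= E) -> forall x, `|K a v x - K a w x| <= E.
Proof.
have main (v1 w1 : X -> R) : (forall x, `|v1 x - w1 x| <= E) ->
    forall x, - E <= K a v1 x - K a w1 x.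
  move=> vw x.
  have vw' z : - E <= v1 z - w1 z by have [] := norm_bounds (vw z).
  have := log_avg_diff_ge PX_gt0 (W_pmf ^~ a) (lexx 0) ler01 vw' (x := x).
  rewrite mul0r addr0; apply => y _; rewrite mul0r.
  by rewrite !mulr_ge0 ?expR_ge0 ?(ltW (PX_gt0 _))//; case: (W_pmf x a).
move=> vw x; have wv z : `|w z - v z| <= E by rewrite distrC.
have h1 := main _ _ vw x; have h2 := main _ _ wv x.
by rewrite ler_norml; apply/andP; split; lra.
Qed.

(** One action suffices: [l - l'] is the difference of the [v] plus that of the [K], and [K] is
    nonexpansive, so [l - l'] is at most twice the Euclidean norm of [v a - v' a]. This gives the
    factor [4]; each factor [#|X|] comes from one summation over the source alphabet. *)
Lemma kkt_strong l l' v v' (L e : R) a : S a -> kkt l v -> kkt l' v' ->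
  0 < e -> (forall x, e <= PX x) ->
  (forall x, L <= v a x) -> (forall x, L <= v' a x) ->
  e * expR L * \sum_x (l x - l' x) ^+ 2 <= 4 * #|X|%:R * #|X|%:R *
    \sum_x PX x * ((l x - l' x) * (total_mass v x - total_mass v' x)).
Proof.
move=> Sa lv lv' e0 eP vL v'L; set G := \sum_x PX x * _.
have eL : 0 < e * expR L by rewrite mulr_gt0 ?expR_gt0.
pose d x := v a x - v' a x.
have dG x : e * expR L * d x ^+ 2 <= G.
  apply: le_trans (kkt_gap_ge x lv lv' Sa); rewrite -mulrA.
  apply: ler_pM; rewrite ?(ltW e0) ?eP//.
    by rewrite mulr_ge0 ?expR_ge0 ?sqr_ge0.
  exact: expR_mono_ge.
pose E := Num.sqrt (\sum_x d x ^+ 2).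
have ge0 : 0 <= \sum_x d x ^+ 2 by apply: sumr_ge0 => x _; exact: sqr_ge0.
have dE x : `|v a x - v' a x| <= E.
  rewrite -sqrtr_sqr ler_wsqrtr// (bigD1 x)//= lerDl.
  by apply: sumr_ge0 => z _; exact: sqr_ge0.
have lE x : (l x - l' x) ^+ 2 <= 4 * E ^+ 2.
  have -> : l x - l' x = (v a x - v' a x) + (K a (v a) x - K a (v' a) x).
    by have := lv a Sa x; have := lv' a Sa x; lra.
  have [h1 h2] := norm_bounds (dE x).
  have [h3 h4] := norm_bounds (log_avg_lipschitz a dE x).
  have E0 : 0 <= E by exact: sqrtr_ge0.
  have : `|v a x - v' a x + (K a (v a) x - K a (v' a) x)| <= 2 * E.
    by rewrite ler_norml; apply/andP; split; lra.
  rewrite -(@ler_pXn2r _ 2)// ?nnegrE ?normr_ge0 ?mulr_ge0//.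
  rewrite real_normK ?num_real// => h; apply: le_trans h _.
  by rewrite exprMn; lra.
have E2 : e * expR L * E ^+ 2 <= #|X|%:R * G.
  rewrite sqr_sqrtr// mulr_sumr mulr_natl -sumr_const.
  by apply: ler_sum => x _; exact: dG.
apply: (@le_trans _ _ (e * expR L * (#|X|%:R * (4 * E ^+ 2)))).
  rewrite ler_pM2l// mulr_natl -sumr_const; apply: ler_sum => x _; exact: lE.
have : 4 * #|X|%:R * (e * expR L * E ^+ 2) <= 4 * #|X|%:R * (#|X|%:R * G).
  by rewrite ler_wpM2l// mulr_ge0.
lra.
Qed.

Lemma total_mass_ge v a x : S a -> expR (v a x) <= total_mass v x.
Proof.
move=> Sa; rewrite /total_mass (bigD1 a)//= lerDl.
by apply: sumr_ge0 => b _; exact: expR_ge0.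
Qed.

Lemma total_mass_ge0 v x : 0 <= total_mass v x.
Proof. by apply: sumr_ge0 => b _; exact: expR_ge0. Qed.

Lemma total_mass_le v (U : R) x : (forall a, S a -> v a x <= U) ->
  total_mass v x <= #|A|%:R * expR U.
Proof.
move=> vU; rewrite mulr_natl -sumr_const /total_mass big_mkcond/=.
apply: ler_sum => a _; case: ifPn => Sa; last exact: expR_ge0.
by rewrite ler_expR vU.
Qed.

(* [g] is [ln 2]: the multipliers of the algorithm are exponents of 2. *)
Definition subgradient_path (g : R) (mu : nat -> X -> R)
    (v : nat -> A -> X -> R) :=
  [/\ forall x, mu 0%N x = 1, forall i, kkt (fun x => mu i x * g) (v i) &
    forall i x, mu i.+1 x =
      mu i x + (i.+1%:R)^-1 / PX x * (1 - total_mass (v i) x)].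

(** * Boundedness, descent and convergence of the multiplier path *)

Lemma step_bound : exists2 h : R, 0 <= h & forall i x,
  0 <= (i.+1%:R)^-1 / PX x <= h.
Proof.
have [h h0 hP] := upper_bound_fin (fun x => (PX x)^-1).
exists h => // i x; apply/andP; split.
  by rewrite divr_ge0// ltW.
apply: le_trans (le_trans (ler_norm _) (hP x)).
by rewrite ler_piMl ?invr_ge0 ?(ltW (PX_gt0 _))// invf_le1 ?ler1n.
Qed.

Lemma path_bounded (g : R) (mu : nat -> X -> R)
    (v : nat -> A -> X -> R) a0 :
  0 < g -> S a0 -> subgradient_path g mu v ->
  exists M N : R, (forall i x, mu i x <= M) /\ (forall i x, - N <= mu i x).
Proof.
move=> g0 Sa0 [mu0 kktP muS].
have [B B0 BP] := kkt_bound; have [h h0 hP] := step_bound.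
(* Where [mu i x >= M - h], [kkt_bound] gives [v i a0 x >= M * g / 2 - h * g - 2 * B = g / 2], so
   the total mass is at least [1] and [mu] does not increase there. Below [M - h] one step adds at
   most [h]. *)
pose M := 1 + 2 * h + 4 * B / g.
have gM : M * g = g + 2 * h * g + 4 * B
  by rewrite /M !mulrDl mul1r divfK// gt_eqF.
have M1 : 1 + 2 * h <= M by rewrite /M lerDl divr_ge0// ?mulr_ge0// ltW.
clearbody M.
have up i x : mu i x <= M.
  elim: i x => [|i IH] x; first by rewrite mu0; lra.
  rewrite muS; have /andP[t0 th] := hP i x.
  set t := _ / _ in t0 th *; set n := total_mass _ _.
  have [le|lt] := leP (M - h) (mu i x); last first.
    have n0 : 0 <= n by exact: total_mass_ge0.
    have : 0 <= t * n by exact: mulr_ge0.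
    lra.
  have lM z : mu i z * g <= M * g by rewrite ler_pM2r.
  have vlow := (BP _ _ (kktP i)).2 _ lM a0 x Sa0.
  have : (M - h) * g <= mu i x * g by rewrite ler_pM2r.
  have hg : 0 <= h * g by rewrite mulr_ge0// ltW.
  move=> le'; have v0 : 0 <= v i a0 x by lra.
  have n1 : 1 <= n.
    apply: le_trans (total_mass_ge (v i) x Sa0).
    by rewrite -expR0 ler_expR.
  have : 0 <= t * (n - 1) by rewrite mulr_ge0// subr_ge0.
  have := IH x; lra.
have Ap : (0 : R) < #|A|%:R by rewrite ltr0n; apply/card_gt0P; exists a0.
pose U := B + M * g / 2; pose Nn := #|A|%:R * expR U.
(* Where [mu i x <= - B1], [kkt_bound] gives [v i a x <= - ln #|A|], so the total mass is at most
   [1] and [mu] does not decrease there. Above [- B1] one step subtracts at most [h * Nn]. *)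
pose B1 := 2 * (B + ln #|A|%:R) / g.
have gB1 : B1 * g = 2 * (B + ln #|A|%:R) by rewrite /B1 divfK// gt_eqF.
have lnA : 0 <= ln (#|A|%:R : R) by rewrite ln_ge0// ler1n -(ltr0n R).
have B10 : 0 <= B1 by rewrite /B1 divr_ge0 ?mulr_ge0 ?addr_ge0// ltW.
have Nn0 : 0 <= Nn by rewrite mulr_ge0 ?expR_ge0.
clearbody B1.
have hN : 0 <= h * Nn by exact: mulr_ge0.
exists M, (B1 + h * Nn); split=> // i x.
elim: i x => [|i IH] x; first by rewrite mu0; lra.
rewrite muS; have /andP[t0 th] := hP i x.
set t := _ / _ in t0 th *; set n := total_mass _ _.
have [le|lt] := leP (mu i x) (- B1).
  have n1 : n <= 1.
    apply: (@le_trans _ _ (#|A|%:R * expR (- ln #|A|%:R))).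
      apply: total_mass_le => a Sa; have := (BP _ _ (kktP i)).1 a x Sa.
      have : mu i x * g <= - B1 * g by rewrite ler_pM2r.
      lra.
    by rewrite expRN lnK ?posrE// divff// gt_eqF.
  have : 0 <= t * (1 - n) by rewrite mulr_ge0// subr_ge0.
  have := IH x; lra.
have nN : n <= Nn.
  apply: total_mass_le => a Sa; apply: le_trans ((BP _ _ (kktP i)).1 a x Sa) _.
  by rewrite lerD2l ler_pM2r ?invr_gt0// ler_pM2r.
have n0 : 0 <= n by exact: total_mass_ge0.
have : t * n <= h * Nn by rewrite ler_pM.
lra.
Qed.

(* [th i ^ 2 |r i|^2] and [|r i.+1 - r i|^2] are both at most a constant times
   the monotonicity gap [D i], which equals
   [g * th i * \sum_x r i x * (r i x - r i.+1 x)]; so [|r i|^2] decreases by a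
   factor [1 - k th i] once [th i] is small. *)
Lemma path_descent (g : R) (mu : nat -> X -> R)
    (v : nat -> A -> X -> R) a0 :
  0 < g -> S a0 -> subgradient_path g mu v ->
  exists k : R, 0 < k /\ exists N : nat,
    let s i := Num.sqrt (\sum_x (1 - total_mass (v i) x) ^+ 2) in
    forall i, (N <= i)%N -> k * (harmonic i * s i) <= s i - s i.+1.
Proof.
move=> g0 Sa0 gp; have [M [N [up low]]] := path_bounded g0 Sa0 gp.
case: gp => mu0 kktP muS.
have [B B0 BP] := kkt_bound.
have [e e0 eP] := pos_lower_bound PX.
have {}eP x : e <= PX x by exact: eP.
pose U := B + M * g / 2; pose Lo := - N * g - M * g / 2 - 2 * B.
have vU i a x : S a -> v i a x <= U.
  move=> Sa; apply: le_trans ((BP _ _ (kktP i)).1 a x Sa) _.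
  by rewrite lerD2l ler_pM2r ?invr_gt0// ler_pM2r.
have vL i x : Lo <= v i a0 x.
  have lM z : mu i z * g <= M * g by rewrite ler_pM2r.
  apply: le_trans ((BP _ _ (kktP i)).2 _ lM a0 x Sa0).
  by rewrite /Lo !lerD2r ler_pM2r.
have Ap : (0 : R) < #|A|%:R by rewrite ltr0n; apply/card_gt0P; exists a0.
have Xp : (0 : R) < #|X|%:R.
  have [x0 _] := pmf_inhabited PX_pmf.
  by rewrite ltr0n; apply/card_gt0P; exists x0.
pose C1 := 4 * #|X|%:R * #|X|%:R / (e * expR Lo).
pose C2 := #|A|%:R * expR U / e.
have eL0 : 0 < e * expR Lo by rewrite mulr_gt0 ?expR_gt0.
have C10 : 0 < C1 by rewrite divr_gt0// !mulr_gt0.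
have C20 : 0 < C2 by rewrite divr_gt0// mulr_gt0 ?expR_gt0.
pose n i x := total_mass (v i) x.
pose l i x := mu i x * g.
pose D i := \sum_x PX x * ((l i.+1 x - l i x) * (n i.+1 x - n i x)).
have D1 i : \sum_x (l i.+1 x - l i x) ^+ 2 <= C1 * D i.
  rewrite /C1 mulrAC ler_pdivlMr// mulrC.
  exact: (kkt_strong Sa0 (kktP i.+1) (kktP i) e0 eP (vL _) (vL _)).
have D2 i : \sum_x (n i.+1 x - n i x) ^+ 2 <= C2 * D i.
  rewrite /C2 mulrAC ler_pdivlMr// mulrC.
  apply: le_trans (kkt_cocoercive (kktP i.+1) (kktP i) (vU _) (vU _)).
  rewrite mulr_sumr; apply: ler_sum => x _.
  by rewrite ler_wpM2r ?sqr_ge0.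
have D0 i : 0 <= D i.
  rewrite -(pmulr_rge0 _ C20); apply: le_trans (D2 i).
  by apply: sumr_ge0 => x _; exact: sqr_ge0.
pose r i x := 1 - n i x.
pose rho i := \sum_x r i x ^+ 2.
pose th i : R := (i.+1%:R)^-1.
have th0 i : 0 < th i by rewrite invr_gt0.
have lS i x : l i.+1 x - l i x = g * th i * (r i x / PX x).
  by rewrite /l muS /r /n /th; ring.
have DE i : D i = g * th i * \sum_x r i x * (r i x - r i.+1 x).
  rewrite mulr_sumr; apply: eq_bigr => x _; rewrite lS /r.
  by field; rewrite gt_eqF.
have D3 i : (g * th i) ^+ 2 * rho i <= C1 * D i.
  apply: le_trans (D1 i); rewrite mulr_sumr; apply: ler_sum => x _.
  rewrite lS [leRHS]exprMn ler_wpM2l ?sqr_ge0// exprMn ler_peMr ?sqr_ge0//.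
  rewrite expr_ge1 ?invr_ge0 ?(ltW (PX_gt0 _))// invf_ge1//.
  exact: PX_le1.
have rhoS i : rho i.+1 = rho i - 2 * (\sum_x r i x * (r i x - r i.+1 x)) +
    \sum_x (n i.+1 x - n i x) ^+ 2.
  rewrite /rho mulr_sumr -sumrB -big_split/=; apply: eq_bigr => x _.
  by rewrite /r; ring.
(* From [N1] on, the quadratic term of [rhoS] is at most half of the linear decrease. *)
have [N1 N1P] : exists N1 : nat, forall i, (N1 <= i)%N -> g * th i * C2 <= 1.
  exists (Num.bound (g * C2)) => i iN.
  rewrite /th mulrAC ler_pdivrMr// mul1r.
  apply: ltW; apply: lt_le_trans (archi_boundP _) _.
    by rewrite mulr_ge0// ltW.
  by rewrite ler_nat ltnW.
have rhod i : (N1 <= i)%N -> g / C1 * th i * rho i <= rho i - rho i.+1.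
  move=> iN; have gt : 0 < g * th i by rewrite mulr_gt0.
  have := D3 i; have := D2 i; have := rhoS i; have := D0 i; have := DE i.
  set Q := \sum_x r i x * _; set T := \sum_x (n _ x - _) ^+ 2.
  move=> -> D0' -> D2' D3'.
  have Q0 : 0 <= Q by rewrite -(pmulr_rge0 _ gt).
  have TQ : T <= Q.
    apply: le_trans D2' _; rewrite mulrA mulrC -[leRHS]mulr1 ler_wpM2l//.
    by rewrite mulrC; exact: N1P.
  have rQ : g * th i * rho i <= C1 * Q.
    rewrite -(ler_pM2l gt) mulrA -expr2; apply: le_trans D3' _.
    by rewrite mulrCA.
  have -> : g / C1 * th i * rho i = C1^-1 * (g * th i * rho i) by ring.
  have : C1^-1 * (g * th i * rho i) <= Q.
    by rewrite ler_pdivrMl.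
  lra.
have rho0 i : 0 <= rho i by apply: sumr_ge0 => x _; exact: sqr_ge0.
have k0 : 0 < g / C1 by rewrite divr_gt0.
(* Passing from [rho = s ^ 2] to [s] costs a factor [2]: for [0 <= b <= a],
   [a ^ 2 - b ^ 2 <= 2 * a * (a - b)]. *)
exists (g / C1 / 2); split; first by rewrite divr_gt0.
exists N1 => s i iN; have := rhod i iN.
have -> : harmonic i = th i by [].
have s0 j : 0 <= s j by exact: sqrtr_ge0.
have sE j : rho j = s j ^+ 2 by rewrite sqr_sqrtr// rho0.
have kt0 : 0 < g / C1 * th i by rewrite mulr_gt0.
rewrite !sE; set kt := g / C1 * th i in kt0 *.
have -> : g / C1 / 2 * (th i * s i) = kt * s i / 2 by rewrite /kt; ring.
move: kt0 (s0 i) (s0 i.+1); clearbody kt.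
move: (s i) (s i.+1) => a b kt0 a0' b0 h.
have ba : b <= a.
  rewrite -(@ler_pXn2r _ 2)// ?nnegrE//.
  by rewrite -subr_ge0; apply: le_trans h; rewrite mulr_ge0 ?sqr_ge0 ?(ltW kt0).
have h2 : kt * a ^+ 2 <= (a - b) * (2 * a).
  apply: le_trans h _; have -> : a ^+ 2 - b ^+ 2 = (a - b) * (a + b) by ring.
  by rewrite ler_wpM2l ?subr_ge0//; lra.
move: a0'; rewrite le_eqVlt => /predU1P[a0'|a0'].
  by rewrite -a0' mulr0 mul0r; lra.
rewrite -(ler_pM2r a0'); lra.
Qed.

(** By [path_descent] each increment of [mu] is at most a constant times the decrease of the
    residual norm [s], so [mu] converges. *)
Lemma subgradient_path_cvg (g : R) (mu : nat -> X -> R)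
    (v : nat -> A -> X -> R) a0 :
  0 < g -> S a0 -> subgradient_path g mu v ->
  exists (mu' : X -> R) (v' : A -> X -> R), [/\
    forall x, (fun i => mu i x) @ \oo --> mu' x,
    forall a x, S a -> (fun i => v i a x) @ \oo --> v' a x,
    kkt (fun x => mu' x * g) v' & forall x, total_mass v' x = 1].
Proof.
move=> g0 Sa0 gp; have [M [N [up low]]] := path_bounded g0 Sa0 gp.
have [k [k0 [N1 sP]]] := path_descent g0 Sa0 gp.
set s := fun i : nat => Num.sqrt _ in sP.
case: gp => mu0 kktP muS.
have [B B0 BP] := kkt_bound;
  have [h h0 hP] := upper_bound_fin (fun x => (PX x)^-1).
have s0 i : 0 <= s i by exact: sqrtr_ge0.
have rs i x : `|1 - total_mass (v i) x| <= s i.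
  rewrite -sqrtr_sqr ler_wsqrtr// (bigD1 x)//= lerDl.
  by apply: sumr_ge0 => z _; exact: sqr_ge0.
have cv x : cvgn (fun i => mu i x).
  apply: (@cvgn_dominated_steps _ N1 _ (fun i => h / k * s i)).
    by move=> i; rewrite mulr_ge0 ?divr_ge0// ltW.
  move=> i iN; have t0 : 0 <= (harmonic i : R) by exact: harmonic_ge0.
  have p0 : 0 <= (PX x)^-1 by rewrite invr_ge0 ltW.
  have hp : (PX x)^-1 <= h by apply: le_trans (ler_norm _) (hP x).
  rewrite muS addrAC subrr add0r normrM ger0_norm; last exact: mulr_ge0.
  apply: (@le_trans _ _ (h / k * (k * (harmonic i * s i)))).
    have -> : h / k * (k * (harmonic i * s i)) = harmonic i * h * s i.
      by field; rewrite gt_eqF.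
    by apply: ler_pM => //; [exact: mulr_ge0|rewrite ler_wpM2l].
  by rewrite -mulrBr ler_wpM2l ?divr_ge0 ?(ltW k0)// sP.
pose mu' x := limn (fun i => mu i x).
have cv' x : (fun i => mu i x) @ \oo --> mu' x by exact: cv.
(* A solution at the limit multiplier is fixed first and only then shown to be the limit of [v]. *)
have [v' v'P] := kkt_exists (fun x => mu' x * g).
have up' x : mu' x <= M by apply: limr_le => //; near=> i; exact: up.
have low' x : - N <= mu' x by apply: limr_ge => //; near=> i; exact: low.
have [e e0 eP] := pos_lower_bound PX.
have {}eP x : e <= PX x by exact: eP.
pose U := B + M * g / 2; pose Lo := - N * g - M * g / 2 - 2 * B.
have box m w : (forall x, m x <= M) -> (forall x, - N <= m x) ->
    kkt (fun x => m x * g) w -> forall a x, S a -> Lo <= w a x /\ w a x <= U.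
  move=> mM mN mw a x Sa; split; last first.
    apply: le_trans ((BP _ _ mw).1 a x Sa) _.
    by rewrite lerD2l ler_pM2r ?invr_gt0// ler_pM2r.
  have lM z : m z * g <= M * g by rewrite ler_pM2r.
  apply: le_trans ((BP _ _ mw).2 _ lM a x Sa).
  by rewrite /Lo !lerD2r ler_pM2r.
pose Nn := #|A|%:R * expR U.
have tm m w : (forall x, m x <= M) -> (forall x, - N <= m x) ->
    kkt (fun x => m x * g) w -> forall x, 0 <= total_mass w x <= Nn.
  move=> mM mN mw x; rewrite total_mass_ge0/=; apply: total_mass_le => a Sa.
  by have [] := box _ _ mM mN mw a x Sa.
have eL0 : 0 < e * expR Lo by rewrite mulr_gt0 ?expR_gt0.
have cvv a x : S a -> (fun i => v i a x) @ \oo --> v' a x.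
  (* Strong monotonicity of [expR] bounds the squared distance by the gap of [kkt_gap_ge]. This gap
     is controlled by the distance of the multipliers, since both total masses lie between [0] and
     [Nn]. *)
  move=> Sa; pose z i := (e * expR Lo)^-1 * \sum_x `|mu i x - mu' x| * (g * Nn).
  apply: (@squeeze_sqr _ _ z) => [i|].
    rewrite ler_pdivlMl//.
    have [v1 _] := box _ _ (up i) (low i) (kktP i) a x Sa.
    have [v2 _] := box _ _ up' low' v'P a x Sa.
    apply: (@le_trans _ _ (PX x * ((v i a x - v' a x) *
        (expR (v i a x) - expR (v' a x))))).
      rewrite -mulrA; apply: ler_pM; rewrite ?(ltW e0) ?eP//.
        by rewrite mulr_ge0 ?expR_ge0 ?sqr_ge0.
      exact: expR_mono_ge.
    apply: le_trans (kkt_gap_ge x (kktP i) v'P Sa) _.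
    apply: ler_sum => y _; apply: le_trans (ler_norm _) _.
    rewrite normrM ger0_norm ?(ltW (PX_gt0 _))// -mulrBl !normrM.
    rewrite -[leRHS]mul1r; apply: ler_pM => //.
    - exact: ltW.
    - exact: PX_le1.
    rewrite -mulrA ler_wpM2l// [`|g|]ger0_norm ?(ltW g0)// ler_wpM2l
      ?(ltW g0)//.
    have /andP[t1 t2] := tm _ _ (up i) (low i) (kktP i) y.
    have /andP[t3 t4] := tm _ _ up' low' v'P y.
    by rewrite ler_norml; apply/andP; split; lra.
  have -> : (0 : R) = (e * expR Lo)^-1 * \sum_(x : X) 0 * (g * Nn).
    by rewrite big1 ?mulr0// => y _; rewrite mul0r.
  apply: cvgMl_tmp; apply: cvg_sumr => y _; apply: cvgMr_tmp.
  by apply/norm_cvg0P; apply/subr_cvg0.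
exists mu', v'; split=> // x.
have cvt : (fun i => total_mass (v i) x) @ \oo --> total_mass v' x.
  apply: cvg_sumr => a Sa.
  exact: (@continuous_cvg _ _ _ _ _ _ expR _ (@continuous_expR R _) (cvv a x Sa)).
(* Otherwise [s] would stay above [d / 2] from some index on, and its descent would dominate a
   multiple of the harmonic series. *)
apply: contrapT => ne1; set d := `|1 - total_mass v' x|.
have d0 : 0 < d by rewrite normr_gt0 subr_eq0 eq_sym; apply/eqP.
have cvd : (fun i => `|1 - total_mass (v i) x|) @ \oo --> d.
  by apply: cvg_norm; apply: cvgB => //; exact: cvg_cst.
have [N2 _ N2P] : \forall i \near \oo, d / 2 <= `|1 - total_mass (v i) x|.
  by apply: (cvgr_ge d cvd); lra.
apply: (@harmonic_not_dominated _ (maxn N1 N2) s (k * (d / 2))) => //.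
  by rewrite mulr_gt0// divr_gt0.
move=> i; rewrite geq_max => /andP[i1 i2]; apply: le_trans (sP i i1).
rewrite -mulrA ler_pM2l// [leRHS]mulrC ler_wpM2r ?harmonic_ge0//.
exact: le_trans (N2P i i2) (rs i x).
Unshelve. all: by end_near. Qed.

End Dual.

(** * Algorithm 2 *)

Section Algorithm2.
Context {R : realType} {X Xh Y A : finType}.
Variables (PX : X -> R) (W : X -> A -> Y -> R).
Variables (Delta : A -> R) (d : X -> Xh -> R).
Variable TT : {set {ffun Y -> Xh} * A}.
Local Notation T := (strategy TT).
Hypotheses (PX_pmf : is_pmf PX) (PX_gt0 : forall x, 0 < PX x).
Hypothesis W_pmf : forall x a, is_pmf (W x a).
Variables (s m beta : R) (QTY : T * Y -> R) (QA : A -> R).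
Hypotheses (beta_gt0 : 0 < beta) (beta_lt1 : beta < 1).
Hypothesis QA_gt0 : forall t : T, 0 < QA (act t).
Hypothesis QTY_gt0 : forall (t : T) x y, 0 < W x (act t) y -> 0 < QTY (t, y).

Let W_ge0 x a y : 0 <= W x a y. Proof. by case: (W_pmf x a). Qed.

Local Notation alphat := (alpha_t W Delta d s m QTY QA).
Local Notation alphaa := (alpha_a W Delta d s m QTY QA).

Lemma ln2_gt0 : 0 < ln 2 :> R.
Proof. by rewrite ln_gt0// ltr1n. Qed.

Lemma elog2_EFin (x : R) : 0 < x -> elog2 x%:E = (log2 x)%:E.
Proof. by move=> x0; rewrite /elog2 lne_EFin. Qed.

Lemma alpha_tE t x : alphat t x = QA (act t) * expR (ln 2 * (m * Delta (act t) +
  \sum_y W x (act t) y * (s * d x (recon t y) + log2 (QTY (t, y))))).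
Proof.
rewrite /alpha_t -mulrA; congr (_ * _).
have -> : (\sum_y (W x (act t) y)%:E *
    ((s * d x (recon t y))%:E + elog2 (QTY (t, y))%:E))%E =
    (\sum_y W x (act t) y * (s * d x (recon t y) + log2 (QTY (t, y))))%:E.
  rewrite -sumEFin; apply: eq_bigr => y _.
  have := W_ge0 x (act t) y; rewrite le_eqVlt => /predU1P[<-|Wxy].
    by rewrite mul0e mul0r.
  by rewrite elog2_EFin; [rewrite -EFinD -EFinM|exact: QTY_gt0 Wxy].
rewrite /exp2e -EFinM/= mulrDr expRD; congr (_ * _); last by rewrite mulrC.
by rewrite /powR pnatr_eq0/= [ln 2 * _]mulrC.
Qed.

Lemma alpha_t_gt0 t x : 0 < alphat t x.
Proof. by rewrite alpha_tE mulr_gt0// expR_gt0. Qed.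

(** For the remaining actions [alpha_a] is [0] and there is no logarithm to work with; they are
    treated apart. *)
Definition active : pred A := fun a => [exists t : T, act t == a].

Lemma active_act (t : T) : active (act t).
Proof. by apply/existsP; exists t. Qed.

Lemma alpha_a_gt0 a x : active a -> 0 < alphaa a x.
Proof.
move=> /existsP[t ta]; rewrite /alpha_a (bigD1 t)//=.
rewrite ltr_pwDl ?alpha_t_gt0// sumr_ge0// => u _; exact/ltW/alpha_t_gt0.
Qed.

Lemma alpha_a_eq0 a x : ~~ active a -> alphaa a x = 0.
Proof.
move=> /existsPn na; rewrite /alpha_a big1// => t ta.
by have := na t; rewrite ta.
Qed.

Local Notation c := (fun a x => ln (alphaa a x)).
Local Notation Wa a := (fun x y => W x a y).
Local Notation gmap := (g_map PX W Delta d s m beta QTY QA).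
Local Notation fpiter := (fixpoint_iter PX W Delta d s m beta QTY QA).
Local Notation fplimit := (fixpoint_limit PX W Delta d s m beta QTY QA).

(** In logarithmic coordinates the exponents [beta] and [1 - beta] become the weights of [damped],
    and the product over [y] becomes [log_avg]. *)
Lemma g_map_active mu PA a v : active a -> (forall x, PA a x = expR (v x)) ->
  forall x, gmap mu PA a x =
    expR (damped PX (Wa a) beta (fun x => c a x + mu x * ln 2) v x).
Proof.
move=> aa PAv x; rewrite /g_map /damped PAv.
have -> : \prod_y (\sum_x' PX x' * W x' a y * PA a x') `^ W x a y =
    expR (log_avg PX (Wa a) v x).
  rewrite /log_avg expR_sum; apply: eq_bigr => y _.
  have -> : \sum_x' PX x' * W x' a y * PA a x' = out_weight PX (Wa a) v y.
    by apply: eq_bigr => z _; rewrite PAv.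
  have := W_ge0 x a y; rewrite le_eqVlt => /predU1P[<-|Wxy].
    by rewrite mul0r expR0 powRr0.
  rewrite /powR gt_eqF//; exact: (out_weight_gt0 PX_gt0 (W_pmf ^~ a) v Wxy).
have -> : 2 `^ mu x * alphaa a x = expR (c a x + mu x * ln 2).
  rewrite expRD lnK ?posrE ?alpha_a_gt0// mulrC; congr (_ * _).
  by rewrite /powR pnatr_eq0.
rewrite -expRN -expRD -!expRM -expRD; congr expR.
by rewrite mulrC; congr (_ + _); rewrite mulrC.
Qed.

Lemma g_map_inactive mu PA a x : ~~ active a -> gmap mu PA a x = 0.
Proof.
move=> na; rewrite /g_map alpha_a_eq0// mulr0 mul0r powR0 ?mulr0//.
by rewrite subr_eq0 gt_eqF.
Qed.

Lemma fixpoint_iter_active mu PA a v n :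
  active a -> (forall x, PA a x = expR (v x)) -> forall x,
  fpiter mu PA n a x =
    expR (iter n (damped PX (Wa a) beta (fun x => c a x + mu x * ln 2)) v x).
Proof.
move=> aa PAv; elim: n => [|n IH] x; first exact: PAv.
by rewrite /fixpoint_iter !iterS; apply: g_map_active.
Qed.

Lemma fixpoint_iter_cvg mu PA : (forall a x, active a -> 0 < PA a x) ->
  exists v, kkt PX W c active (fun x => mu x * ln 2) v /\
  forall a x, (fun n => fpiter mu PA n a x) @ \oo -->
    (if active a then expR (v a x) else 0).
Proof.
move=> PA0.
have H a := damped_iter_cvg PX_pmf PX_gt0 (W_pmf ^~ a)
  (fun x => c a x + mu x * ln 2) (fun x => ln (PA a x)) beta_gt0 beta_lt1.
have [v vP] := choice H.
exists v; split=> [a _ x|a x]; first by case: (vP a) => _; exact.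
case: ifPn => aa; last first.
  (* The start value of an inactive entry may be nonzero, but every later iterate is [0]. *)
  rewrite -(cvg_shiftS (fun n => fpiter mu PA n a x)).
  under eq_fun do rewrite /fixpoint_iter iterS g_map_inactive//.
  exact: cvg_cst.
have PAE z : PA a z = expR (ln (PA a z)) by rewrite lnK// posrE PA0.
under eq_fun do rewrite (fixpoint_iter_active mu _ aa PAE).
have [h _] := vP a.
exact: (@continuous_cvg _ _ _ _ _ _ expR _ (@continuous_expR R _) (h x)).
Qed.

Local Notation mu_ := (alg2_mu PX W Delta d s m beta QTY QA).
Local Notation PA_ := (alg2_PA PX W Delta d s m beta QTY QA).

Lemma alg2_PAS i : PA_ i.+1 = fplimit (mu_ i) (PA_ i).
Proof. by rewrite /alg2_PA /alg2_mu /=; case: alg2_state. Qed.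

Lemma alg2_muS i x : mu_ i.+1 x =
  mu_ i x + (i.+1%:R)^-1 / PX x * (1 - \sum_a PA_ i.+1 a x).
Proof. by rewrite /alg2_PA /alg2_mu /=; case: alg2_state. Qed.

Variable t0 : T.

Lemma alg2_PA_gt0 i a x : active a -> 0 < PA_ i a x.
Proof.
elim: i a x => [|i IH] a x aa.
  by rewrite /alg2_PA/= invr_gt0 ltr0n; apply/card_gt0P; exists (val t0);
    exact: valP.
rewrite alg2_PAS /fixpoint_limit.
have [v [_ vP]] := fixpoint_iter_cvg (mu_ i) IH.
by rewrite (cvg_lim _ (vP a x))// aa expR_gt0.
Qed.

(** Within one action the output is proportional to [alpha_t] and sums to [P_{A|X}], so the KKT
    equation for actions lifts to one for strategies; total mass [1] gives the normalisation. *)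
Theorem alg2_spec : alg2_converges PX W Delta d s m beta QTY QA /\
  let P := alg2_output PX W Delta d s m beta QTY QA in
  [/\ cond_pmf P, forall x t, 0 < P x t & exists mu : X -> R, forall x t,
    ln (P x t) + \sum_y W x (act t) y * ln (PYA PX W P y (act t)) =
    ln (alphat t x) + mu x * ln 2].
Proof.
have H i := fixpoint_iter_cvg (mu_ i) (@alg2_PA_gt0 i).
have [v vP] := choice H.
have PAE i a x : PA_ i.+1 a x = if active a then expR (v i a x) else 0.
  by rewrite alg2_PAS /fixpoint_limit; apply: cvg_lim => //; case: (vP i).
(* Mind the shift of index: [v i], which belongs to [mu_ i], is the logarithm of the active entries
   of [PA_ i.+1]. *)
have path : subgradient_path PX W c active (ln 2) mu_ v.
  split=> [x|i|i x]; first by [].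
    by case: (vP i).
  rewrite alg2_muS; congr (_ + _ * (_ - _)).
  rewrite /total_mass [RHS]big_mkcond; apply: eq_bigr => a _.
  by rewrite PAE.
have [mu' [v' [muc vc kv' mass]]] :=
  subgradient_path_cvg PX_pmf PX_gt0 W_pmf ln2_gt0 (active_act t0) path.
have PAc a x : (fun i => PA_ i a x) @ \oo -->
    (if active a then expR (v' a x) else 0).
  rewrite -(cvg_shiftS (fun i => PA_ i a x)).
  under eq_fun do rewrite PAE.
  case: ifPn => aa; last exact: cvg_cst.
  exact: (@continuous_cvg _ _ _ _ _ _ expR _ (@continuous_expR R _) (vc a x aa)).
split.
  split=> [i a x|x|a x].
  - by case: (vP i) => _ /(_ a x) /cvgP.
  - exact: cvgP (muc x).
  - exact: cvgP (PAc a x).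
move=> P.
have PE x t : P x t = alphat t x / alphaa (act t) x * expR (v' (act t) x).
  rewrite /P /alg2_output; congr (_ * _).
  by rewrite (cvg_lim _ (PAc (act t) x))// active_act.
have P0 x t : 0 < P x t.
  by rewrite PE mulr_gt0 ?expR_gt0// divr_gt0 ?alpha_t_gt0 ?alpha_a_gt0
    ?active_act.
have Pa x a : active a -> \sum_(t | act t == a) P x t = expR (v' a x).
  move=> aa.
  rewrite (eq_bigr (fun t => alphat t x * ((alphaa a x)^-1 * expR (v' a x)))).
    by rewrite -mulr_suml mulrA divff ?mul1r// gt_eqF ?alpha_a_gt0.
  by move=> t /eqP ta; rewrite PE ta mulrA.
split=> //.
  move=> x; split=> [t|]; first exact: ltW.
  rewrite -[RHS](mass x) (partition_big (@act _ _ _ TT) active)/=; last first.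
    by move=> t _; exact: active_act.
  by apply: eq_bigr => a aa; exact: Pa.
exists mu' => x t.
have PYAE y : PYA PX W P y (act t) = out_weight PX (Wa (act t)) (v' (act t)) y.
  apply: eq_bigr => z _; rewrite -(Pa _ _ (active_act t)) mulr_sumr.
  by apply: eq_bigr => u /eqP ut; rewrite /PXYT ut; ring.
under eq_bigr do rewrite PYAE.
have := kv' _ (active_act t) x; rewrite -/(log_avg _ _ _ _).
have at0 := alpha_t_gt0 t x; have aa0 := alpha_a_gt0 x (active_act t).
rewrite PE lnM ?posrE ?expR_gt0 ?divr_gt0// ln_div ?posrE// expRK.
rewrite /log_avg => h.
rewrite -[X in X + _]addrA -addrA; congr (_ + _).
by rewrite -addrA h; ring.
Qed.

End Algorithm2.

(** * The objective and relative entropies *)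

Lemma sum_pair (V : nmodType) (I J : finType) (f : I * J -> V) :
  \sum_p f p = \sum_i \sum_j f (i, j).
Proof.
by rewrite pair_bigA; apply: eq_bigr => -[].
Qed.

(** * Base-2 logarithms and relative entropy *)

Section KullbackLeibler.
Context {R : realType}.
Implicit Types p q x y : R.

Lemma log2M x y : 0 < x -> 0 < y -> log2 (x * y) = log2 x + log2 y.
Proof. by move=> x0 y0; rewrite /log2 lnM ?posrE// mulrDl. Qed.

Lemma log2V x : 0 < x -> log2 x^-1 = - log2 x.
Proof. by move=> x0; rewrite /log2 lnV ?posrE// mulNr. Qed.

Lemma log2_div x y : 0 < x -> 0 < y -> log2 (x / y) = log2 x - log2 y.
Proof. by move=> x0 y0; rewrite log2M ?invr_gt0// log2V. Qed.

(** This is [ln u <= u - 1] at [u = x / p]. The linear left side is kept because it cancels, or has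
    a sign, after summation. *)
Lemma mul_log2_ge p x : 0 <= p -> 0 <= x -> (0 < p -> 0 < x) ->
  (p - x) / ln 2 <= p * (log2 p - log2 x).
Proof.
move=> p0 x0 px; rewrite /log2 -mulrBl mulrA ler_pM2r ?invr_gt0 ?ln2_gt0//.
move: p0; rewrite le_eqVlt => /predU1P[<-|p0];
  first by rewrite mul0r sub0r oppr_le0.
have {}x0 := px p0.
have h : ln (x / p) <= x / p - 1.
  have -> : x / p = 1 + (x / p - 1) by ring.
  have -> : 1 + (x / p - 1) - 1 = x / p - 1 by ring.
  by apply: le_ln1Dx; rewrite ltrBrDl subrr divr_gt0.
have : p * ln (x / p) <= p * (x / p - 1) by rewrite ler_pM2l.
have -> : p * (x / p - 1) = x - p by field; rewrite gt_eqF.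
by rewrite ln_div ?posrE//; lra.
Qed.

Lemma kl_term_EFin p q : 0 <= p -> (0 < p -> 0 < q) ->
  kl_term p q = (p * (log2 p - log2 q))%:E.
Proof.
rewrite le_eqVlt => /predU1P[<- _|p0 /(_ p0) q0].
  by rewrite /kl_term mul0e mul0r.
by rewrite /kl_term inver gt_eqF// -EFinM elog2_EFin ?divr_gt0// log2_div.
Qed.

(** Tangent bound at the reference point [r], affine in [q]. For [p > 0] and [q = 0] the right side
    is [+oo]. *)
Lemma kl_term_ge p q r : 0 <= p -> 0 <= q -> (0 < p -> 0 < r) ->
  ((p * (log2 p - log2 r) + (p - p / r * q) / ln 2)%:E <= kl_term p q)%E.
Proof.
rewrite le_eqVlt => /predU1P[<- _ _|p0 q0 /(_ p0) r0].
  by rewrite /kl_term mul0e !mul0r subrr mul0r addr0.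
move: q0; rewrite le_eqVlt => /predU1P[<-|q0].
  rewrite /kl_term inver eqxx gt0_muley ?lte_fin// /elog2/= gt0_mulye.
    by rewrite gt0_muley ?lte_fin// leey.
  by rewrite lte_fin invr_gt0 ln2_gt0.
rewrite kl_term_EFin ?(ltW p0)// lee_fin.
have x0 : 0 < p / r * q by rewrite mulr_gt0// divr_gt0.
have := mul_log2_ge (ltW p0) (ltW x0) (fun _ => x0).
rewrite (log2M (divr_gt0 p0 r0) q0) log2_div//; lra.
Qed.

Lemma log_sum_inequality (I : finType) (p p' : I -> R) :
  (forall i, 0 <= p i) -> (forall i, 0 <= p' i) ->
  (forall i, 0 < p i -> 0 < p' i) ->
  (\sum_i p i) * (log2 (\sum_i p i) - log2 (\sum_i p' i)) <=
  \sum_i p i * (log2 (p i) - log2 (p' i)).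
Proof.
move=> p0 p'0 pp'; set r := \sum_i p i; set r' := \sum_i p' i.
have : 0 <= r by exact: sumr_ge0.
rewrite le_eqVlt => /predU1P[r0|r0].
  have z i : p i = 0.
    have /eqP := esym r0; rewrite /r psumr_eq0// => /allP /(_ i).
    by rewrite mem_index_enum => /(_ isT) /eqP.
  by rewrite -r0 mul0r big1// => i _; rewrite z mul0r.
have r'0 : 0 < r'.
  have [i pi] : exists i, 0 < p i.
    apply: contrapT => no; move: r0; rewrite /r big1 ?ltxx// => i _.
    by apply/eqP; rewrite eq_le p0 andbT leNgt; apply/negP => ?; apply: no;
      exists i.
  by rewrite /r' (bigD1 i)//= ltr_pwDl ?pp'// sumr_ge0.
(* These corrections sum to [0]; once they are added, the inequality holds term by term. *)
have E : \sum_i (p i - p' i * (r / r')) / ln 2 = 0.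
  rewrite -mulr_suml sumrB -mulr_suml -/r -/r' mulrCA divff ?mulr1 ?subrr
    ?mul0r//.
  by rewrite gt_eqF.
rewrite -[leLHS]addr0 -[X in _ + X <= _]E {1}/r mulr_suml -big_split/=;
  apply: ler_sum => i _.
have [pi|] := ltP 0 (p i); last first.
  move=> pi; have -> : p i = 0 by apply/eqP; rewrite eq_le pi p0.
  rewrite !mul0r !add0r mulNr oppr_le0.
  by rewrite !mulr_ge0 ?invr_ge0 ?(ltW ln2_gt0) ?(ltW r'0) ?(ltW r0).
have x0 : 0 < p' i * (r / r') by rewrite mulr_gt0 ?pp'// divr_gt0.
have := mul_log2_ge (ltW pi) (ltW x0) (fun _ => x0).
rewrite (log2M (pp' _ pi) (divr_gt0 r0 r'0)) log2_div//; lra.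
Qed.

Lemma weighted_kl_EFin (I J : finType) (w : J -> R) (p : J -> I -> R)
    (q : I -> R) :
  (forall j i, 0 <= p j i) -> (forall j i, 0 < p j i -> 0 < q i) ->
  (\sum_j (w j)%:E * \sum_i kl_term (p j i) (q i))%E =
  (\sum_j w j * \sum_i p j i * (log2 (p j i) - log2 (q i)))%:E.
Proof.
move=> p0 pq; rewrite -sumEFin; apply: eq_bigr => j _; rewrite EFinM;
  congr (_ * _)%E.
rewrite -sumEFin; apply: eq_bigr => i _; apply: kl_term_EFin => //; exact: pq.
Qed.

(** The mixture of the [p j] is the best second argument. With the mixture as reference in
    [kl_term_ge], the corrections add up to [1] minus the mass that [q] gives to the support of the
    mixture. *)
Lemma weighted_kl_ge (I J : finType) (w : J -> R) (p : J -> I -> R)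
    (q : I -> R) :
  (forall j, 0 < w j) -> (forall j i, 0 <= p j i) -> is_pmf q ->
  \sum_i \sum_j w j * p j i = 1 ->
  ((\sum_j w j * \sum_i p j i *
      (log2 (p j i) - log2 (\sum_j w j * p j i)))%:E <=
   \sum_j (w j)%:E * \sum_i kl_term (p j i) (q i))%E.
Proof.
move=> w0 p0 [q0 q1] r1; pose r i := \sum_j w j * p j i.
have r0 i : 0 <= r i by apply: sumr_ge0 => j _; rewrite mulr_ge0// ltW.
have pr j i : 0 < p j i -> 0 < r i.
  move=> pji; rewrite /r (bigD1 j)//= ltr_pwDl ?mulr_gt0//.
  by apply: sumr_ge0 => k _; rewrite mulr_ge0// ltW.
apply: (@le_trans _ _ (\sum_j w j *
  \sum_i (p j i * (log2 (p j i) - log2 (r i)) +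
   (p j i - p j i / r i * q i) / ln 2))%:E).
  rewrite lee_fin -subr_ge0 -sumrB.
  under eq_bigr => j _ do rewrite big_split/= mulrDr addrAC subrr add0r -mulr_suml mulrA.
  rewrite -mulr_suml mulr_ge0 ?invr_ge0 ?(ltW ln2_gt0)//.
  under eq_bigr => j _ do rewrite mulr_sumr.
  rewrite exchange_big/= -[leLHS](subrr 1) -[in X in X - _]r1 -[in X in _ - X]q1.
  rewrite -sumrB; apply: ler_sum => i _.
  under [leRHS]eq_bigr => j _ do rewrite mulrBr.
  rewrite sumrB lerD2l lerN2.
  have -> : \sum_j w j * (p j i / r i * q i) = r i / r i * q i.
    by rewrite /r !mulr_suml; apply: eq_bigr => j _; rewrite !mulrA.
  have := r0 i; rewrite le_eqVlt => /predU1P[<-|ri]; first by rewrite !mul0r.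
  by rewrite divff ?mul1r// gt_eqF.
rewrite -sumEFin; apply: lee_sum => j _; rewrite EFinM lee_pmul2l ?lte_fin//.
rewrite -sumEFin; apply: lee_sum => i _; apply: kl_term_ge => //; exact: pr.
Qed.

End KullbackLeibler.

(** * The objective as an expectation under the joint law, and its minimisation over [Q] *)

Section Objective.
Context {R : realType} {X Xh Y A : finType}.
Variables (PX : X -> R) (W : X -> A -> Y -> R).
Variables (Delta : A -> R) (d : X -> Xh -> R).
Variable TT : {set {ffun Y -> Xh} * A}.
Local Notation T := (strategy TT).
Hypotheses (PX_pmf : is_pmf PX) (PX_gt0 : forall x, 0 < PX x).
Hypothesis W_pmf : forall x a, is_pmf (W x a).
Variables s m : R.
Implicit Types P : X -> T -> R.

Let W_ge0 x a y : 0 <= W x a y. Proof. by case: (W_pmf x a). Qed.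
Let W_sum x a : \sum_y W x a y = 1. Proof. by case: (W_pmf x a). Qed.

Local Notation PXYT := (PXYT PX W).
Local Notation PYA := (PYA PX W).
Local Notation F := (F PX W Delta d s m).
Local Notation updTY := (update_QTY PX W).
Local Notation updA := (@update_QA _ _ _ _ _ PX TT).

Lemma sum_YA P (g : Y -> A -> R) :
  \sum_y \sum_a PYA P y a * g y a =
  \sum_x \sum_y \sum_t PXYT P x y t * g y (act t).
Proof.
rewrite [RHS]exchange_big; apply: eq_bigr => y _ /=.
have E x : \sum_t PXYT P x y t * g y (act t) =
    \sum_a (\sum_(t | act t == a) PXYT P x y t) * g y a.
  rewrite (partition_big (@act _ _ _ TT) xpredT)//=; apply: eq_bigr => a _.
  by rewrite mulr_suml; apply: eq_bigr => t /eqP ->.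
under [RHS]eq_bigr do rewrite E.
by rewrite [RHS]exchange_big; apply: eq_bigr => a _ /=; rewrite -mulr_suml.
Qed.

Lemma updA_PYA P a : updA P a = \sum_y PYA P y a.
Proof.
rewrite /update_QA /Defs.PYA [RHS]exchange_big.
apply: eq_bigr => x _ /=; rewrite [RHS]exchange_big; apply: eq_bigr => t _ /=.
by rewrite /Defs.PXYT -mulr_sumr W_sum mulr1.
Qed.

Lemma sum_A P (g : A -> R) :
  \sum_a updA P a * g a = \sum_x \sum_y \sum_t PXYT P x y t * g (act t).
Proof.
rewrite -(sum_YA P (fun _ => g)) exchange_big; apply: eq_bigr => a _ /=.
by rewrite -mulr_suml updA_PYA.
Qed.

Lemma sum_TY P (g : T * Y -> R) :
  \sum_ty updTY P ty * g ty = \sum_x \sum_y \sum_t PXYT P x y t * g (t, y).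
Proof.
rewrite sum_pair.
under [RHS]eq_bigr do rewrite exchange_big.
rewrite [RHS]exchange_big; apply: eq_bigr => t _ /=.
rewrite [RHS]exchange_big; apply: eq_bigr => y _ /=.
rewrite /update_QTY/= mulr_suml; apply: eq_bigr => x _; rewrite /Defs.PXYT;
  ring.
Qed.

Lemma sum_XT P (g : X -> T -> R) :
  \sum_x \sum_y \sum_t PXYT P x y t * g x t =
  \sum_x \sum_t PX x * P x t * g x t.
Proof.
apply: eq_bigr => x _; rewrite exchange_big; apply: eq_bigr => t _ /=.
by rewrite -mulr_suml /Defs.PXYT -mulr_sumr W_sum mulr1.
Qed.

Lemma PXYT_ge0 P : cond_pmf P -> forall x y t, 0 <= PXYT P x y t.
Proof.
move=> P_pmf x y t; rewrite !mulr_ge0// ?(ltW (PX_gt0 _))//.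
by case: (P_pmf x).
Qed.

Lemma PYA_ge0 P : cond_pmf P -> forall y a, 0 <= PYA P y a.
Proof.
by move=> Pp y a; apply: sumr_ge0 => x _; apply: sumr_ge0 => t _;
  exact: PXYT_ge0.
Qed.

Lemma PYA_ge P x y t : cond_pmf P -> PXYT P x y t <= PYA P y (act t).
Proof.
move=> Pp; rewrite /Defs.PYA (bigD1 x)//= (bigD1 t)//= -addrA lerDl addr_ge0//.
  by apply: sumr_ge0 => u _; exact: PXYT_ge0.
by apply: sumr_ge0 => z _; apply: sumr_ge0 => u _; exact: PXYT_ge0.
Qed.

Lemma updTY_ge P x y t : cond_pmf P -> PXYT P x y t <= updTY P (t, y).
Proof.
move=> Pp; rewrite /update_QTY (bigD1 x)//= /Defs.PXYT mulrAC lerDl.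
apply: sumr_ge0 => z _; rewrite !mulr_ge0// ?(ltW (PX_gt0 _))//.
by case: (Pp z).
Qed.

Lemma updA_ge P x t : cond_pmf P -> PX x * P x t <= updA P (act t).
Proof.
move=> Pp.
have h z u : 0 <= PX z * P z u.
  by rewrite mulr_ge0// ?(ltW (PX_gt0 _))//; case: (Pp z).
rewrite /update_QA (bigD1 x)//= (bigD1 t)//= -addrA lerDl addr_ge0//.
  exact: sumr_ge0.
by apply: sumr_ge0 => z _; exact: sumr_ge0.
Qed.

Lemma PXYT_gt0 P x y t : cond_pmf P -> 0 < PXYT P x y t ->
  0 < P x t /\ 0 < W x (act t) y.
Proof.
move=> Pp; have P0 : 0 <= P x t by case: (Pp x).
rewrite /Defs.PXYT -mulrA pmulr_rgt0// => h; split.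
  by rewrite lt_def P0 andbT; apply: contraTneq h => ->; rewrite mul0r ltxx.
by rewrite lt_def W_ge0 andbT; apply: contraTneq h => ->; rewrite mulr0 ltxx.
Qed.

Lemma PYA_gt0 P y a : cond_pmf P -> 0 < PYA P y a ->
  exists x t, act t = a /\ 0 < PXYT P x y t.
Proof.
move=> Pp h; apply: contrapT => no; move: h;
  rewrite /Defs.PYA big1 ?ltxx// => x _.
rewrite big1// => t /eqP ta; apply/eqP; rewrite eq_le PXYT_ge0// andbT leNgt.
by apply/negP => h; apply: no; exists x, t.
Qed.

Lemma PXYT_sum P : cond_pmf P -> \sum_x \sum_y \sum_t PXYT P x y t = 1.
Proof.
move=> Pp; transitivity (\sum_x \sum_y \sum_t PXYT P x y t * 1).
  by do 3!(apply: eq_bigr => ? _); rewrite mulr1.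
rewrite (sum_XT P (fun _ _ => 1)) -[RHS](PX_pmf.2); apply: eq_bigr => x _.
under eq_bigr do rewrite mulr1.
by rewrite -mulr_sumr; case: (Pp x) => _ ->; rewrite mulr1.
Qed.

Lemma updA_pmf P : cond_pmf P -> is_pmf (updA P).
Proof.
move=> Pp; split=> [a|].
  apply: sumr_ge0 => x _; apply: sumr_ge0 => t _;
    rewrite mulr_ge0 ?(ltW (PX_gt0 _))//.
  by case: (Pp x).
rewrite -(PXYT_sum Pp); transitivity (\sum_i updA P i * 1);
  first by apply: eq_bigr => ? _; rewrite mulr1.
by rewrite (sum_A P (fun _ => 1)); do 3!(apply: eq_bigr => ? _); rewrite mulr1.
Qed.

Lemma updTY_pmf P : cond_pmf P -> is_pmf (updTY P).
Proof.
move=> Pp; split=> [[t y]|].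
  apply: sumr_ge0 => x _; rewrite !mulr_ge0 ?(ltW (PX_gt0 _))//.
  by case: (Pp x).
rewrite -(PXYT_sum Pp); transitivity (\sum_i updTY P i * 1);
  first by apply: eq_bigr => ? _; rewrite mulr1.
by rewrite (sum_TY P (fun _ => 1)); do 3!(apply: eq_bigr => ? _); rewrite mulr1.
Qed.

(** The real form of [F]: the logarithm of [W] that [F] subtracts has been cancelled against the one
    inside the divergence of [P_{Y,T|X}]. *)
Definition objective P (QTY : T * Y -> R) (QA : A -> R) : R :=
  \sum_x \sum_y \sum_t PXYT P x y t *
    (log2 (PYA P y (act t)) - log2 (QA (act t)) + log2 (P x t) -
     log2 (QTY (t, y)) - s * d x (recon t y) - m * Delta (act t)).

Lemma objectiveE P QTY QA : cond_pmf P ->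
  \sum_y 1 * \sum_a PYA P y a * (log2 (PYA P y a) - log2 (QA a))
  - \sum_x \sum_y \sum_t PXYT P x y t * log2 (W x (act t) y)
  + \sum_x PX x * \sum_ty PTY_X W P x ty *
      (log2 (PTY_X W P x ty) - log2 (QTY ty))
  - s * \sum_x \sum_y \sum_t PXYT P x y t * d x (recon t y)
  - m * \sum_t \sum_x Delta (act t) * PX x * P x t = objective P QTY QA.
Proof.
move=> Pp.
under eq_bigr do rewrite mul1r.
rewrite (sum_YA P (fun y a => log2 (PYA P y a) - log2 (QA a))).
have -> : \sum_x PX x * (\sum_ty PTY_X W P x ty *
    (log2 (PTY_X W P x ty) - log2 (QTY ty))) =
    \sum_x \sum_y \sum_t PXYT P x y t *
      (log2 (P x t) + log2 (W x (act t) y) - log2 (QTY (t, y))).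
  apply: eq_bigr => x _.
  rewrite sum_pair exchange_big/=.
  rewrite mulr_sumr; apply: eq_bigr => y _; rewrite mulr_sumr;
    apply: eq_bigr => t _.
  rewrite mulrA /PTY_X/= mulrA -/(PXYT P x y t).
  have := PXYT_ge0 Pp x y t; rewrite le_eqVlt => /predU1P[<-|h];
    first by rewrite !mul0r.
  by have [p0 w0] := PXYT_gt0 Pp h; rewrite log2M.
have -> : \sum_t \sum_x Delta (act t) * PX x * P x t =
    \sum_x \sum_y \sum_t PXYT P x y t * Delta (act t).
  rewrite (sum_XT P (fun _ t => Delta (act t))) exchange_big/=.
  by apply: eq_bigr => x _; apply: eq_bigr => t _; ring.
rewrite /objective !mulr_sumr -sumrB -big_split/= -!sumrB;
  apply: eq_bigr => x _.
rewrite !mulr_sumr -sumrB -big_split/= -!sumrB; apply: eq_bigr => y _.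
rewrite !mulr_sumr -sumrB -big_split/= -!sumrB; apply: eq_bigr => t _.
by ring.
Qed.

Lemma F_EFin P QTY QA : cond_pmf P ->
  (forall x y t, 0 < PXYT P x y t -> 0 < QTY (t, y)) ->
  (forall x t, 0 < P x t -> 0 < QA (act t)) ->
  F P QTY QA = (objective P QTY QA)%:E.
Proof.
move=> Pp QTY0 QA0; rewrite -objectiveE// /Defs.F.
have -> : (\sum_y \sum_a
    (PYA P y a)%:E * elog2 ((PYA P y a)%:E / (QA a)%:E))%E =
    (\sum_y 1 * \sum_a PYA P y a * (log2 (PYA P y a) - log2 (QA a)))%:E.
  rewrite -(weighted_kl_EFin (fun=> 1) (p := PYA P) (q := QA)).
  - by apply: eq_bigr => y _; rewrite mul1e.
  - exact: PYA_ge0.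
  by move=> y a /(PYA_gt0 Pp)[x [t [<- /(PXYT_gt0 Pp)[p0 _]]]]; exact: QA0 p0.
rewrite /kl_div (weighted_kl_EFin PX (p := PTY_X W P) (q := QTY))
  => [|x [t y]|x [t y]].
- by [].
- by rewrite /PTY_X mulr_ge0//; case: (Pp x).
rewrite /PTY_X/= => h; apply: (QTY0 x).
by rewrite /Defs.PXYT -mulrA mulr_gt0.
Qed.

(** [QTY] and [QA] enter [F] only through two weighted divergences, each minimised by the
    corresponding marginal. *)
Lemma F_ge P QTY QA : cond_pmf P -> is_pmf QTY -> is_pmf QA ->
  ((objective P (updTY P) (updA P))%:E <= F P QTY QA)%E.
Proof.
move=> Pp QTYp QAp; rewrite -objectiveE// /Defs.F /kl_div.
rewrite !EFinB EFinD EFinB; apply: leeB => //; apply: leeB => //.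
apply: leeD; first apply: leeB => //.
  have updAE a : updA P a = \sum_y 1 * PYA P y a.
    by rewrite updA_PYA; apply: eq_bigr => y _; rewrite mul1r.
  under eq_bigr => y _ do under eq_bigr => a _ do rewrite updAE.
  have h := @weighted_kl_ge _ _ _ (fun=> 1) (PYA P) QA _ (PYA_ge0 Pp) QAp.
  apply: le_trans (h _ _) _ => //.
    under eq_bigr do rewrite -updAE.
    by case: (updA_pmf Pp).
  by rewrite le_eqVlt; apply/orP; left; apply/eqP; apply: eq_bigr => y _;
    rewrite mul1e.
have updE ty : updTY P ty = \sum_x PX x * PTY_X W P x ty.
  by apply: eq_bigr => x _; rewrite /PTY_X; ring.
under eq_bigr => x _ do under eq_bigr => ty _ do rewrite updE.
apply: weighted_kl_ge => //.
  by move=> x [t y]; rewrite /PTY_X mulr_ge0//; case: (Pp x).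
under eq_bigr do rewrite -updE.
by case: (updTY_pmf Pp).
Qed.

Lemma F_update P : cond_pmf P ->
  F P (updTY P) (updA P) = (objective P (updTY P) (updA P))%:E.
Proof.
move=> Pp; apply: F_EFin => // [x y t h|x t h].
  exact: lt_le_trans h (updTY_ge _ _ _ Pp).
by apply: lt_le_trans (updA_ge x t Pp); rewrite mulr_gt0.
Qed.

(** The [V] of the overview: the relative entropy of the kernels averaged over [PX], plus that of
    the laws of [(Y, A)]. *)
Definition divergence P P' : R :=
  \sum_x \sum_y \sum_t PXYT P x y t *
    (log2 (P x t) - log2 (P' x t) +
     (log2 (PYA P y (act t)) - log2 (PYA P' y (act t)))).

(** The left side is the relative entropy of the [(T, Y)] marginals plus that of the [A] marginals.
    By the log-sum inequality, summing out [x] and [y] respectively only decreases the two terms of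
    [divergence]. *)
Lemma objective_update_gap P P' : cond_pmf P -> cond_pmf P' ->
  (forall x t, 0 < P' x t) ->
  objective P (updTY P') (updA P') - objective P (updTY P) (updA P) <=
  divergence P P'.
Proof.
move=> Pp P'p P'0.
have PXYT'_gt0 x y t : 0 < PXYT P x y t -> 0 < PXYT P' x y t.
  by move=> /(PXYT_gt0 Pp)[_ w0]; rewrite /Defs.PXYT !mulr_gt0.
have hTY : \sum_x \sum_y \sum_t PXYT P x y t *
    (log2 (updTY P (t, y)) - log2 (updTY P' (t, y))) <=
    \sum_x \sum_y \sum_t PXYT P x y t * (log2 (P x t) - log2 (P' x t)).
  rewrite -(sum_TY P (fun ty => log2 (updTY P ty) - log2 (updTY P' ty))).
  rewrite [leRHS](_ : _ = \sum_ty \sum_x PX x * W x (act ty.1) ty.2 * P x ty.1 *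
      (log2 (PX x * W x (act ty.1) ty.2 * P x ty.1) -
       log2 (PX x * W x (act ty.1) ty.2 * P' x ty.1))).
    apply: ler_sum => -[t y] _; apply: log_sum_inequality => x.
    - by rewrite !mulr_ge0 ?(ltW (PX_gt0 _))//; case: (Pp x).
    - by rewrite !mulr_ge0 ?(ltW (PX_gt0 _))//; case: (P'p x).
    - by have := @PXYT'_gt0 x y t; rewrite /Defs.PXYT ![_ * W _ _ _]mulrAC.
  rewrite [RHS]exchange_big; apply: eq_bigr => x _ /=.
  rewrite [RHS]sum_pair [RHS]exchange_big; apply: eq_bigr => y _;
    apply: eq_bigr => t _ /=.
  rewrite [PX x * W _ _ _ * P _ _]mulrAC -/(PXYT P x y t).
  have := PXYT_ge0 Pp x y t; rewrite le_eqVlt => /predU1P[<-|h].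
    by rewrite !mul0r.
  have [p0 w0] := PXYT_gt0 Pp h; congr (_ * _).
  by rewrite /Defs.PXYT mulrAC !log2M ?mulr_gt0//; ring.
have hYA : \sum_x \sum_y \sum_t PXYT P x y t *
    (log2 (updA P (act t)) - log2 (updA P' (act t))) <=
    \sum_x \sum_y \sum_t PXYT P x y t *
      (log2 (PYA P y (act t)) - log2 (PYA P' y (act t))).
  rewrite -(sum_A P (fun a => log2 (updA P a) - log2 (updA P' a))).
  rewrite -(sum_YA P (fun y a => log2 (PYA P y a) - log2 (PYA P' y a))).
  rewrite exchange_big; apply: ler_sum => a _ /=; rewrite !updA_PYA.
  apply: log_sum_inequality => y; try exact: PYA_ge0.
  move=> /(PYA_gt0 Pp)[x [t [<- h]]].
  exact: lt_le_trans (PXYT'_gt0 _ _ _ h) (PYA_ge _ _ _ P'p).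
rewrite -subr_ge0; apply: le_trans (_ : 0 <= _ - _ + (_ - _)) _.
  by apply: addr_ge0; rewrite subr_ge0; [exact: hTY|exact: hYA].
rewrite le_eqVlt; apply/orP; left; apply/eqP.
rewrite /divergence /objective -!sumrB -big_split/=; apply: eq_bigr => x _.
rewrite -!sumrB -big_split/=; apply: eq_bigr => y _.
rewrite -!sumrB -big_split/=; apply: eq_bigr => t _.
by ring.
Qed.

Definition stationary P' (QTY : T * Y -> R) (QA : A -> R) (mu : X -> R) :=
  forall x t,
  log2 (P' x t) + \sum_y W x (act t) y * log2 (PYA P' y (act t)) =
  log2 (QA (act t)) + m * Delta (act t) +
  \sum_y W x (act t) y * (s * d x (recon t y) + log2 (QTY (t, y))) + mu x.

(** After [divergence] is subtracted, stationarity makes the average over [y] equal to [mu x] for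
    every pair [(x, t)]; it does not depend on [t], so [P] sums out. *)
Lemma objective_stationary P P' QTY QA mu : cond_pmf P ->
  stationary P' QTY QA mu ->
  objective P QTY QA = \sum_x PX x * mu x + divergence P P'.
Proof.
move=> Pp st; apply/eqP; rewrite -subr_eq; apply/eqP.
transitivity (\sum_x \sum_y \sum_t PXYT P x y t *
   (log2 (P' x t) + log2 (PYA P' y (act t)) - log2 (QA (act t)) -
    m * Delta (act t) - (s * d x (recon t y) + log2 (QTY (t, y))))).
  rewrite /divergence /objective -sumrB; apply: eq_bigr => x _.
  rewrite -sumrB; apply: eq_bigr => y _; rewrite -sumrB; apply: eq_bigr => t _.
  by ring.
apply: eq_bigr => x _; rewrite exchange_big/=.
transitivity (\sum_t PX x * P x t * mu x); last first.
  by rewrite -mulr_suml -mulr_sumr; case: (Pp x) => _ ->; rewrite mulr1.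
apply: eq_bigr => t _.
have -> : mu x = \sum_y W x (act t) y *
   (log2 (P' x t) + log2 (PYA P' y (act t)) - log2 (QA (act t)) -
    m * Delta (act t) - (s * d x (recon t y) + log2 (QTY (t, y)))).
  have cst (k : R) : k = \sum_y W x (act t) y * k.
    by rewrite -mulr_suml W_sum mul1r.
  have := st x t.
  rewrite [X in X + _ = _]cst [X in _ = X + _ + _ + _]cst
    [X in _ = _ + X + _ + _]cst.
  move=> h; apply/esym; rewrite -[RHS](addKr
    (\sum_y W x (act t) y * log2 (QA (act t)) +
    \sum_y W x (act t) y * (m * Delta (act t)) +
    \sum_y W x (act t) y * (s * d x (recon t y) + log2 (QTY (t, y))))) -h.
  rewrite addrC -!big_split/= -sumrB; apply: eq_bigr => y _; ring.
by rewrite mulr_sumr; apply: eq_bigr => y _; rewrite /Defs.PXYT mulrA.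
Qed.

Lemma divergence_refl P : divergence P P = 0.
Proof.
by rewrite /divergence big1// => x _; rewrite big1// => y _;
  rewrite big1// => t _;
  rewrite !subrr addr0 mulr0.
Qed.

(** * The rate in terms of the objective *)

Lemma PXA_sum P x : cond_pmf P -> \sum_a PXA PX P x a = PX x.
Proof.
move=> Pp; transitivity (\sum_t PX x * P x t).
  by rewrite [RHS](partition_big (@act _ _ _ TT) xpredT).
by rewrite -mulr_sumr; case: (Pp x) => _ ->; rewrite mulr1.
Qed.

Lemma PXA_ge P x t : cond_pmf P -> PX x * P x t <= PXA PX P x (act t).
Proof.
move=> Pp; rewrite /PXA (bigD1 t)//= lerDl; apply: sumr_ge0 => u _.
by rewrite mulr_ge0 ?(ltW (PX_gt0 _))//; case: (Pp x).
Qed.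

Lemma mutual_info_PXA P : cond_pmf P -> mutual_info (PXA PX P) =
  \sum_x \sum_y \sum_t PXYT P x y t *
    (log2 (PXA PX P x (act t)) - log2 (PX x) - log2 (updA P (act t))).
Proof.
move=> Pp; rewrite (sum_XT P (fun x t =>
  log2 (PXA PX P x (act t)) - log2 (PX x) - log2 (updA P (act t)))).
rewrite /mutual_info; apply: eq_bigr => x _.
rewrite [RHS](partition_big (@act _ _ _ TT) xpredT)//=; apply: eq_bigr => a _.
rewrite PXA_sum// -/(updA P a) [in LHS]/PXA mulr_suml;
  apply: eq_bigr => t /eqP ta.
rewrite -/(PXA PX P x a) -ta.
have : 0 <= PX x * P x t by rewrite mulr_ge0 ?(ltW (PX_gt0 _))//; case: (Pp x).
rewrite le_eqVlt => /predU1P[<-|h]; first by rewrite !mul0r.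
have h1 := lt_le_trans h (PXA_ge x t Pp);
  have h2 := lt_le_trans h (updA_ge x t Pp).
by rewrite log2_div ?mulr_gt0// log2M// opprD addrA.
Qed.

Lemma cond_mutual_info_PXT_YA P : cond_pmf P ->
  cond_mutual_info (PXT_YA PX W P) =
  \sum_x \sum_y \sum_t PXYT P x y t *
    (log2 (PX x) + log2 (P x t) + log2 (PYA P y (act t)) -
     log2 (PXA PX P x (act t)) - log2 (updTY P (t, y))).
Proof.
move=> Pp; rewrite /cond_mutual_info; apply: eq_bigr => x _.
rewrite [RHS]exchange_big; apply: eq_bigr => t _ /=.
rewrite sum_pair; apply: eq_bigr => y _.
rewrite (bigD1 (act t))//= [X in _ + X]big1 ?addr0; last first.
  by move=> a ta; rewrite /PXT_YA/= eq_sym (negPf ta) mul0r.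
have E1 : \sum_u \sum_v PXT_YA PX W P u v (y, act t) = PYA P y (act t).
  by apply: eq_bigr => u _; rewrite [RHS]big_mkcond.
have E2 : \sum_v PXT_YA PX W P x v (y, act t) =
    W x (act t) y * PXA PX P x (act t).
  rewrite -big_mkcond/= /PXA mulr_sumr; apply: eq_bigr => u /eqP ut.
  by rewrite /Defs.PXYT ut mulrC.
have E3 : \sum_u PXT_YA PX W P u t (y, act t) = updTY P (t, y).
  by apply: eq_bigr => u _; rewrite /PXT_YA/= eqxx /Defs.PXYT mulrAC.
rewrite E1 E2 E3 /PXT_YA/= eqxx.
have := PXYT_ge0 Pp x y t; rewrite le_eqVlt => /predU1P[<-|h];
  first by rewrite !mul0r.
have [p0 w0] := PXYT_gt0 Pp h; congr (_ * _).
have h1 := lt_le_trans h (PYA_ge x y t Pp).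
have h2 := lt_le_trans h (updTY_ge x y t Pp).
have h3 : 0 < PXA PX P x (act t).
  by apply: lt_le_trans (PXA_ge x t Pp); rewrite mulr_gt0.
by rewrite log2_div ?mulr_gt0// !log2M ?mulr_gt0//; ring.
Qed.

(** In the sum of the two informations the logarithms of [PX] and [PXA] cancel. *)
Lemma rateE P : cond_pmf P -> rate PX W P = objective P (updTY P) (updA P) +
  s * expected_distortion PX W d P + m * expected_cost PX Delta P.
Proof.
move=> Pp; rewrite /rate mutual_info_PXA// cond_mutual_info_PXT_YA//.
have -> : expected_cost PX Delta P =
    \sum_x \sum_y \sum_t PXYT P x y t * Delta (act t).
  by rewrite (sum_XT P (fun _ t => Delta (act t))) exchange_big.
rewrite /objective /expected_distortion !mulr_sumr -!big_split/=;
  apply: eq_bigr => x _.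
rewrite !mulr_sumr -!big_split/=; apply: eq_bigr => y _.
rewrite !mulr_sumr -!big_split/=; apply: eq_bigr => t _.
by ring.
Qed.

End Objective.

(** * Existence of minimisers *)

(** Used near [0], where it gives [x * ln x >= - 2 * sqrt x]. *)
Lemma ln_ge_sqrt (R : realType) (x : R) : 0 < x -> - (2 / Num.sqrt x) <= ln x.
Proof.
move=> x0; have s0 : 0 < Num.sqrt x by rewrite sqrtr_gt0.
have -> : ln x = - (2 * ln (Num.sqrt x)^-1).
  rewrite lnV ?posrE// -[x in LHS]sqr_sqrtr ?(ltW x0)// expr2 lnM ?posrE//;
    ring.
have h : ln (Num.sqrt x)^-1 <= (Num.sqrt x)^-1 - 1.
  have -> : (Num.sqrt x)^-1 = 1 + ((Num.sqrt x)^-1 - 1) by ring.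
  have -> : 1 + ((Num.sqrt x)^-1 - 1) - 1 = (Num.sqrt x)^-1 - 1 by ring.
  by apply: le_ln1Dx; rewrite ltrBrDl subrr invr_gt0.
lra.
Qed.

(* As [ln x = 0] for [x <= 0], this holds on the whole line. *)
Lemma mul_ln_continuous (R : realType) : continuous (fun x : R => x * ln x).
Proof.
move=> x; change (y * ln y @[y --> x] --> x * ln x).
have [x0|x0|x0] := ltgtP x 0.
- have -> : x * ln x = 0 by rewrite ln0 ?mulr0// ltW.
  apply: cvg_near_cst; near=> y; rewrite ln0 ?mulr0//.
  by near: y; apply: (cvgr_le x) => //; exact: cvg_id.
- by apply: cvgM; [exact: cvg_id|exact: continuous_ln].
rewrite x0 mul0r; apply/cvgrPdist_le => e e0.
have N : \forall y \near (0 : R), `|y| < Num.min 1 ((e / 2) ^+ 2).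
  apply: (@cvgr_lt _ _ (nbhs (0 : R)) _ (fun y : R => `|y|) _
    (@norm_continuous _ R 0)).
  by rewrite normr0 lt_min ltr01/= exprn_gt0// divr_gt0.
near=> y; rewrite sub0r normrN.
have [y0|y0] := leP y 0; first by rewrite ln0// mulr0 normr0 ltW.
have ye : `|y| < Num.min 1 ((e / 2) ^+ 2) by near: y; exact: N.
move: ye; rewrite lt_min gtr0_norm// => /andP[y1 ye].
rewrite ler0_norm; last by rewrite mulr_ge0_le0 ?(ltW y0)// ln_le0// ltW.
have s0 : 0 < Num.sqrt y by rewrite sqrtr_gt0.
have h : y * - (2 / Num.sqrt y) <= y * ln y by rewrite ler_pM2l// ln_ge_sqrt.
have E : y * - (2 / Num.sqrt y) = - (2 * Num.sqrt y).
  have yE : y = Num.sqrt y ^+ 2 by rewrite sqr_sqrtr// ltW.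
  by rewrite {1}yE; field; rewrite gt_eqF.
have : Num.sqrt y < e / 2.
  rewrite -(@ltr_pXn2r _ 2)// ?nnegrE ?(ltW s0) ?divr_ge0 ?(ltW e0)//.
  by rewrite sqr_sqrtr// ltW.
by move: h; rewrite E; lra.
Unshelve. all: by end_near. Qed.

Lemma continuous_sumr (R : realType) (T : topologicalType) (I : finType)
    (P : pred I) (f : I -> T -> R) :
  (forall i, P i -> continuous (f i)) ->
  continuous (fun v => \sum_(i | P i) f i v).
Proof. by apply: continuous_big; exact: add_continuous. Qed.

Lemma mul_log2_continuous (R : realType) (U : topologicalType) (f : U -> R) :
  continuous f -> continuous (fun v => f v * log2 (f v)).
Proof.
move=> cf v.
have -> : (fun v => f v * log2 (f v)) = (fun v => f v * ln (f v) * (ln 2)^-1).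
  by apply/funext => u; rewrite /log2 mulrA.
apply: cvgMr_tmp.
exact: (@continuous_comp _ _ _ f (fun x => x * ln x) v (cf v)
  (@mul_ln_continuous R (f v))).
Qed.

Section Minimizer.
Context {R : realType} {X Xh Y A : finType}.
Variables (PX : X -> R) (W : X -> A -> Y -> R).
Variables (Delta : A -> R) (d : X -> Xh -> R).
Variable TT : {set {ffun Y -> Xh} * A}.
Local Notation T := (strategy TT).
Hypotheses (PX_pmf : is_pmf PX) (PX_gt0 : forall x, 0 < PX x).
Hypothesis W_pmf : forall x a, is_pmf (W x a).
Variables s m : R.
Implicit Types P : X -> T -> R.

Local Notation PXYT := (PXYT PX W).
Local Notation PYA := (PYA PX W).
Local Notation F := (F PX W Delta d s m).
Local Notation updTY := (update_QTY PX W).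
Local Notation updA := (@update_QA _ _ _ _ _ PX TT).
Local Notation obj := (objective PX W Delta d s m).

(** The minimum of [F] over [QTY] and [QA] for fixed [P]. *)
Definition reduced P := obj P (updTY P) (updA P).

(** Every logarithm is grouped with its own argument, since [u * log2 u] is continuous at [0] and
    [log2] is not. *)
Lemma reducedE : reduced = fun P =>
  \sum_y \sum_a PYA P y a * log2 (PYA P y a)
  - \sum_a updA P a * log2 (updA P a)
  + \sum_x \sum_t PX x * (P x t * log2 (P x t))
  - \sum_ty updTY P ty * log2 (updTY P ty)
  - \sum_x \sum_y \sum_t PXYT P x y t *
      (s * d x (recon t y) + m * Delta (act t)).
Proof.
apply/funext => P; rewrite (sum_YA _ _ P (fun y a => log2 (PYA P y a))).
rewrite (sum_A PX W_pmf P (fun a => log2 (updA P a))).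
rewrite (sum_TY PX W P (fun ty => log2 (updTY P ty))).
have -> : \sum_x \sum_t PX x * (P x t * log2 (P x t)) =
    \sum_x \sum_y \sum_t PXYT P x y t * log2 (P x t).
  rewrite (sum_XT PX W_pmf P (fun x t => log2 (P x t))).
  by apply: eq_bigr => x _; apply: eq_bigr => t _; rewrite mulrA.
rewrite /reduced /objective -!sumrB -big_split/= -!sumrB; apply: eq_bigr => x _.
rewrite -!sumrB -big_split/= -!sumrB; apply: eq_bigr => y _.
rewrite -!sumrB -big_split/= -!sumrB; apply: eq_bigr => t _.
by ring.
Qed.

Local Notation n := #|{: X * T}|.

(* Row vectors carry the compactness results that [X -> T -> R] lacks. *)
Definition kernel_of (v : 'rV[R]_n) (x : X) (t : T) : R :=
  v ord0 (enum_rank (x, t)).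

Lemma kernel_of_surj P : exists v, kernel_of v = P.
Proof.
exists (\row_i P (enum_val i).1 (enum_val i).2).
by apply/funext => x; apply/funext => t; rewrite /kernel_of mxE enum_rankK.
Qed.

Lemma kernel_of_continuous x t : continuous (fun v => kernel_of v x t).
Proof. exact: coord_continuous. Qed.

Lemma reduced_continuous : continuous (fun v => reduced (kernel_of v)).
Proof.
have cP x t := @kernel_of_continuous x t.
have cM (k : R) (f : 'rV[R]_n -> R) : continuous f ->
    continuous (fun v => k * f v).
  by move=> cf v; exact: (@cvgMl_tmp _ _ _ _ f k (f v) (cf v)).
have cMr (k : R) (f : 'rV[R]_n -> R) : continuous f ->
    continuous (fun v => f v * k).
  by move=> cf v; exact: (@cvgMr_tmp _ _ _ _ f (f v) k (cf v)).
have cPXYT x y t : continuous (fun v => PXYT (kernel_of v) x y t).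
  by apply: (cMr); apply: (cM).
have contD (f g : 'rV[R]_n -> R) : continuous f -> continuous g ->
    continuous (fun v => f v + g v).
  by move=> cf cg v; exact: (@cvgD _ _ _ _ _ f g (f v) (g v) (cf v) (cg v)).
have contB (f g : 'rV[R]_n -> R) : continuous f -> continuous g ->
    continuous (fun v => f v - g v).
  by move=> cf cg v; exact: (@cvgB _ _ _ _ _ f g (f v) (g v) (cf v) (cg v)).
rewrite reducedE.
apply: (contB); last first.
  do 3!(apply: continuous_sumr => ? _); exact: cMr.
apply: (contB); last first.
  apply: continuous_sumr => ty _; apply: mul_log2_continuous.
  by apply: continuous_sumr => x _; apply: (cM).
apply: (contD); last first.
  do 2!(apply: continuous_sumr => ? _); apply: (cM).
  exact: mul_log2_continuous.
apply: (contB); last first.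
  apply: continuous_sumr => a _; apply: mul_log2_continuous.
  by do 2!(apply: continuous_sumr => ? _); apply: (cM).
do 2!(apply: continuous_sumr => ? _); apply: mul_log2_continuous.
by do 2!(apply: continuous_sumr => ? _).
Qed.

Lemma cond_pmf_compact : compact [set v | cond_pmf (kernel_of v)].
Proof.
have -> : [set v | cond_pmf (kernel_of v)] =
    [set v : 'rV[R]_n | forall i, `[0, 1]%classic (v ord0 i)] `&`
    \bigcap_(x in setT)
      ((fun v => \sum_t kernel_of v x t) @^-1` [set r | r = 1]).
  apply/seteqP; split=> v /=.
    move=> vP; split=> [i|x _]; last by case: (vP x).
    have -> : v ord0 i = kernel_of v (enum_val i).1 (enum_val i).2.
      by rewrite /kernel_of -surjective_pairing enum_valK.
    move: (enum_val i) => [x t] /=; have [v0 v1] := vP x.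
    rewrite in_itv/= v0/= -v1 (bigD1 t)//= lerDl sumr_ge0// => u _; exact: v0.
  move=> [v01 v1] x; split=> [t|]; last exact: v1.
  by have := v01 (enum_rank (x, t)); rewrite /= in_itv/= => /andP[].
apply: compact_closedI.
  apply: (@rV_compact R n (fun=> `[0, 1]%classic)) => i; exact: segment_compact.
apply: closed_bigI => x _; apply: preimage_closed; last exact: closed_eq.
move=> v _; apply: continuous_sumr => t _; exact: kernel_of_continuous.
Qed.

Lemma reduced_minimum (P0 : X -> T -> R) : cond_pmf P0 -> exists2 P,
  cond_pmf P & forall P', cond_pmf P' -> reduced P <= reduced P'.
Proof.
move=> P0p; have [v0 v0E] := kernel_of_surj P0.
have [|v vA vmin] := @EVT_min_rV _ _ (fun v => reduced (kernel_of v)) _ _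
    cond_pmf_compact (continuous_subspaceT reduced_continuous).
  by exists v0; rewrite /= v0E.
exists (kernel_of v); first by move: vA; rewrite inE.
move=> P'; have [w <-] := kernel_of_surj P' => wp.
by apply: vmin; rewrite inE.
Qed.

Lemma F_minimizer_update P : cond_pmf P ->
  (forall P', cond_pmf P' -> reduced P <= reduced P') ->
  F_minimizer PX W Delta d s m P (updTY P) (updA P).
Proof.
move=> Pp Pmin; split=> // [||P' QTY' QA' P'p TYp Ap].
- exact: updTY_pmf.
- exact: updA_pmf.
rewrite F_update//.
apply: le_trans (F_ge Delta d PX_pmf PX_gt0 W_pmf s m P'p TYp Ap).
by rewrite lee_fin; exact: Pmin.
Qed.

Lemma F_minimizer_reduced P QTY QA : F_minimizer PX W Delta d s m P QTY QA ->
  F P QTY QA = (reduced P)%:E /\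
  forall P', cond_pmf P' -> reduced P <= reduced P'.
Proof.
move=> [Pp TYp Ap Fmin].
have FE : F P QTY QA = (reduced P)%:E.
  apply/eqP; rewrite eq_le; apply/andP; split; last exact: F_ge.
  by rewrite /reduced -F_update//; apply: Fmin => //;
    [exact: updTY_pmf|exact: updA_pmf].
split=> // P' P'p; rewrite -lee_fin -FE /reduced -F_update//.
by apply: Fmin => //; [exact: updTY_pmf|exact: updA_pmf].
Qed.

(** Lagrangian argument: the rate is [reduced] plus [s] times the distortion plus [m] times the
    cost, and since [s] and [m] are nonpositive a feasible kernel cannot make the last two terms
    smaller. *)
Lemma RDC_minimizer P : s <= 0 -> m <= 0 -> cond_pmf P ->
  (forall P', cond_pmf P' -> reduced P <= reduced P') ->
  RDC PX W Delta d TT (expected_distortion PX W d P)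
    (expected_cost PX Delta P) =
  (rate PX W P)%:E.
Proof.
move=> s0 m0 Pp Pmin; apply/eqP; rewrite eq_le; apply/andP; split.
  by apply: ereal_inf_lbound; exists P.
apply: le_ereal_inf_tmp => _ [P' [P'p cP' dP'] <-]; rewrite lee_fin.
rewrite !(rateE Delta d PX_gt0 W_pmf s m)// -!addrA lerD//; first exact: Pmin.
by rewrite lerD// ler_wnM2l.
Qed.

End Minimizer.

(** * Algorithm 1 *)

Lemma telescoping_cvg0 (R : realType) (a V : nat -> R) :
  (forall k, 0 <= a k) -> (forall k, 0 <= V k) ->
  (forall k, a k <= V k - V k.+1) -> a @ \oo --> 0.
Proof.
move=> a0 V0 aV.
have cV : cvgn V.
  apply: (@cvgn_dominated_steps _ 0 _ V) => // k _.
  by rewrite distrC ger0_norm// (le_trans (a0 k)).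
apply: (@squeeze_cvgr _ _ _ _ (fun=> 0) (fun k => V k - V k.+1)).
- by near=> k; rewrite a0 aV.
- exact: cvg_cst.
rewrite -[X in _ --> X](subrr (limn V)); apply: cvgB => //.
by rewrite (cvg_shiftS V).
Unshelve. all: by end_near. Qed.

Section Algorithm1.
Context {R : realType} {X Xh Y A : finType}.
Variables (PX : X -> R) (W : X -> A -> Y -> R).
Variables (Delta : A -> R) (d : X -> Xh -> R).
Variable TT : {set {ffun Y -> Xh} * A}.
Local Notation T := (strategy TT).
Hypotheses (PX_pmf : is_pmf PX) (PX_gt0 : forall x, 0 < PX x).
Hypothesis W_pmf : forall x a, is_pmf (W x a).
Variables s m beta : R.
Hypotheses (beta_gt0 : 0 < beta) (beta_lt1 : beta < 1).
Implicit Types P : X -> T -> R.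

Local Notation updTY := (update_QTY PX W).
Local Notation updA := (@update_QA _ _ _ _ _ PX TT).
Local Notation obj := (objective PX W Delta d s m).

(** Such a kernel yields updates that are positive wherever Algorithm 2 takes their logarithm, and
    the output is again such a kernel. *)
Definition positive_kernel P := cond_pmf P /\ forall x t, 0 < P x t.

Lemma alg2_update P : positive_kernel P ->
  let P' := alg2_output PX W Delta d s m beta (updTY P) (updA P) in
  [/\ alg2_converges PX W Delta d s m beta (updTY P) (updA P),
      positive_kernel P' &
      exists mu, stationary PX W Delta d s m P' (updTY P) (updA P) mu].
Proof.
move=> [Pp P0] P'.
have [x0 _] := pmf_inhabited PX_pmf; have [t0 _] := pmf_inhabited (Pp x0).
have QA0 (t : T) : 0 < updA P (act t).
  by apply: lt_le_trans (updA_ge PX_gt0 x0 t Pp); rewrite mulr_gt0.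
have QTY0 (t : T) x y : 0 < W x (act t) y -> 0 < updTY P (t, y).
  move=> w0; apply: lt_le_trans (updTY_ge PX_gt0 W_pmf x y t Pp).
  by rewrite /PXYT !mulr_gt0.
have [cv [P'p P'0 [mu muP]]] := alg2_spec Delta d PX_pmf PX_gt0 W_pmf s m
  beta_gt0 beta_lt1 QA0 QTY0 t0.
split=> //; exists mu => x t; have := muP x t.
rewrite (alpha_tE Delta d W_pmf s m (updA P) QTY0) lnM ?posrE ?expR_gt0// expRK.
have l0 : ln 2 != 0 :> R by rewrite gt_eqF// ln2_gt0.
have -> : log2 (P' x t) + \sum_y W x (act t) y * log2 (PYA PX W P' y (act t)) =
    (ln (P' x t) + \sum_y W x (act t) y * ln (PYA PX W P' y (act t))) / ln 2.
  rewrite mulrDl mulr_suml; congr (_ + _).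
  by apply: eq_bigr => y _; rewrite mulrA.
move=> ->; set Z := \sum_y _ * _.
by rewrite /log2; field.
Qed.

Lemma F_positive_update P P' : cond_pmf P -> positive_kernel P' ->
  F PX W Delta d s m P (updTY P') (updA P') = (obj P (updTY P') (updA P'))%:E.
Proof.
move=> Pp [P'p P'0].
apply: F_EFin => // [x y t /(PXYT_gt0 PX_gt0 W_pmf Pp)[_ w0]|x t _].
  apply: lt_le_trans (updTY_ge PX_gt0 W_pmf x y t P'p).
  by rewrite /PXYT !mulr_gt0.
by apply: lt_le_trans (updA_ge PX_gt0 x t P'p); rewrite mulr_gt0.
Qed.

(** It dominates the gap of [objective_update_gap], which is nonnegative because the updates of [P]
    are optimal for [P]. *)
Lemma divergence_ge0 P P' : cond_pmf P -> positive_kernel P' ->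
  0 <= divergence PX W P P'.
Proof.
move=> Pp P'p; have [P'1 P'0] := P'p.
apply: le_trans (objective_update_gap Delta d PX_gt0 W_pmf s m Pp P'1 P'0).
rewrite subr_ge0 -lee_fin -(F_positive_update Pp P'p).
by apply: F_ge => //; [exact: updTY_pmf|exact: updA_pmf].
Qed.

Variable P0 : X -> T -> R.
Hypothesis P0_positive : positive_kernel P0.

Local Notation P_ := (alg1_P PX W Delta d s m beta P0).
Local Notation QTY_ := (alg1_QTY PX W Delta d s m beta P0).
Local Notation QA_ := (alg1_QA PX W Delta d s m beta P0).

Lemma alg1_positive k : positive_kernel (P_ k).
Proof. by elim: k => [//|k IH]; case: (alg2_update IH). Qed.

Lemma alg1_F k : F PX W Delta d s m (P_ k.+1) (QTY_ k.+1) (QA_ k.+1) =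
  (obj (P_ k.+1) (QTY_ k.+1) (QA_ k.+1))%:E.
Proof.
apply: F_positive_update (alg1_positive k).
by case: (alg1_positive k.+1).
Qed.

Lemma alg1_objective_cvg (Pm : X -> T -> R) : cond_pmf Pm ->
  (forall P : X -> T -> R, cond_pmf P ->
    reduced PX W Delta d s m Pm <= reduced PX W Delta d s m P) ->
  (fun k => obj (P_ k.+1) (QTY_ k.+1) (QA_ k.+1)) @ \oo -->
  reduced PX W Delta d s m Pm.
Proof.
move=> Pmp Pmin; apply/subr_cvg0.
apply: (@telescoping_cvg0 _ _ (fun k => divergence PX W Pm (P_ k))) => k.
- have [Pp _] := alg1_positive k; have [Pp' _] := alg1_positive k.+1.
  rewrite subr_ge0; apply: le_trans (Pmin _ Pp') _.
  rewrite -lee_fin -alg1_F; apply: F_ge => //; first exact: updTY_pmf.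
  exact: updA_pmf.
- exact/divergence_ge0/alg1_positive.
have [Pp P_gt0] := alg1_positive k; have [Pp' _] := alg1_positive k.+1.
have gap := objective_update_gap Delta d PX_gt0 W_pmf s m Pmp Pp P_gt0.
have [_ _ [mu st]] := alg2_update (alg1_positive k).
(* Taken at the new iterate, where the divergence vanishes, the identity evaluates its constant;
   taken at the minimiser, it produces the divergence to the new iterate. Combined with [gap], this
   telescopes. *)
have E1 := objective_stationary W_pmf Pp' st.
have E2 := objective_stationary W_pmf Pmp st.
rewrite divergence_refl addr0 in E1.
rewrite -/(QTY_ k.+1) -/(QA_ k.+1) in E1 E2 gap.
rewrite E1; move: gap; rewrite E2 /reduced; lra.
Qed.

End Algorithm1.

Unset Implicit Arguments.

Theorem proposition4 (R : realType) (X Xh Y A : finType)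
  (PX : X -> R) (W : X -> A -> Y -> R) (Delta : A -> R) (d : X -> Xh -> R)
  (TT : {set {ffun Y -> Xh} * A})
  (PX_pmf : is_pmf PX) (PX_gt0 : forall x, 0 < PX x)
  (W_pmf : forall x a, is_pmf (W x a))
  (Delta_ge0 : forall a, 0 <= Delta a) (Delta_eq0 : exists a, Delta a = 0)
  (d_ge0 : forall x xh, 0 <= d x xh)
  (d_eq0 : forall x, exists xh, d x xh = 0)
  (s m beta : R) (s_le0 : s <= 0) (m_le0 : m <= 0)
  (beta_gt0 : 0 < beta) (beta_lt1 : beta < 1)
  (P0 : X -> strategy TT -> R)
  (P0_pmf : cond_pmf P0) (P0_gt0 : forall x t, 0 < P0 x t) :
  let P := alg1_P PX W Delta d s m beta P0 in
  let QTY := alg1_QTY PX W Delta d s m beta P0 in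
  let QA := alg1_QA PX W Delta d s m beta P0 in
  [/\ forall k, (0 < k)%N ->
        alg2_converges PX W Delta d s m beta (QTY k) (QA k),
      exists (Pstar : X -> strategy TT -> R) QTYstar QAstar,
        F_minimizer PX W Delta d s m Pstar QTYstar QAstar &
      forall (Pstar : X -> strategy TT -> R) QTYstar QAstar,
        F_minimizer PX W Delta d s m Pstar QTYstar QAstar ->
        let C := expected_cost PX Delta Pstar in
        let D := expected_distortion PX W d Pstar in
        (exists2 P' : X -> strategy TT -> R, feasible PX W Delta d D C P' &
                   RDC PX W Delta d TT D C = (rate PX W P')%:E) /\
        ((s * D + m * C)%:E + F PX W Delta d s m (P k) (QTY k) (QA k)
          @[k --> \oo] --> RDC PX W Delta d TT D C)%E].

Proof.
move=> P QTY QA.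
have P0p : positive_kernel P0 by [].
have [x0 _] := pmf_inhabited PX_pmf.
split.
- move=> [//|k] _.
  by case: (alg2_update Delta d PX_pmf PX_gt0 W_pmf s m beta_gt0 beta_lt1
    (alg1_positive Delta d PX_pmf PX_gt0 W_pmf s m beta_gt0 beta_lt1 P0p k)).
- have [Pm Pmp Pmin] := reduced_minimum PX Delta d W_pmf s m P0_pmf.
  exists Pm, (update_QTY PX W Pm), (update_QA PX Pm).
  exact: F_minimizer_update.
move=> Pm QTYm QAm minP C D.
have [_ Pmin] := F_minimizer_reduced PX_pmf PX_gt0 W_pmf minP.
have Pmp : cond_pmf Pm by case: minP.
have RE := RDC_minimizer PX_gt0 W_pmf s_le0 m_le0 Pmp Pmin.
split; first by exists Pm.
(* The sequence is followed from index [1] on, where [alg1_F] makes [F] a real number; its limit is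
   the rate of the minimiser by [rateE]. *)
pose g k := s * D + m * C +
  objective PX W Delta d s m (P k.+1) (QTY k.+1) (QA k.+1).
have gP : g @ \oo --> rate PX W Pm.
  rewrite (rateE Delta d PX_gt0 W_pmf s m Pmp) -addrA addrC.
  by apply: cvgD; [exact: cvg_cst|exact: alg1_objective_cvg].
rewrite RE -(cvg_shiftS (fun k => (s * D + m * C)%:E +
  F PX W Delta d s m (P k) (QTY k) (QA k))%E).
have -> : (fun k => (s * D + m * C)%:E +
    F PX W Delta d s m (P k.+1) (QTY k.+1) (QA k.+1))%E = (fun k => (g k)%:E).
  by apply/funext => k; rewrite alg1_F.
by apply: cvg_EFin; [near=> k|exact: gP].
Unshelve. all: by end_near. Qed.
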